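(* Let $(f_0,g_0)\in L^\infty(\Omega)\times L^\infty(\Omega')$, let $\eta>0$ and define the coordinate gradient ascent iterates $$f_{n+1} := f_{n} + \eta\, \mathrm{D}_1\Gamma(f_n,g_n), \qquad g_{n+1} := g_{n} + \eta\, \mathrm{D}_2\Gamma(f_{n+1},g_n), \qquad n\geq0.$$ For every $\eta\in (0,\varepsilon/\sqrt{2})$ and all $n\ge 0$, $$\max ( \|f_{n+1} - f_{*}\|_{\infty}, \|g_{n+1} - g_{*}\|_{\infty}) \leq \max ( \|f_{n} - f_{*}\|_{\infty}, \|g_{n} - g_{*}\|_{\infty})$$ and the suboptimality gap $\Delta_n : = \mathrm{QOT}_\varepsilon(P,Q)- \Gamma(f_n,g_n)$ satisfies $$\Delta_n \leq (1-q)^n \Delta_0\qquad\text{for}\qquad q:= \frac{\eta \left(1- \frac{\eta}{2\varepsilon}\right) } {2\gamma_\varepsilon\max(2\|f_{0}\oplus g_{0} - f_*\oplus g_*\|_\infty , \varepsilon)}.$$ Moreover, $$\|f_n\oplus g_n - f_*\oplus g_*\|_{L^2(P\otimes Q)}^2\leq \frac{2\gamma_\varepsilon^2\max(2\|f_{0}\oplus g_{0} - f_*\oplus g_*\|_\infty , \varepsilon)^2}{\eta \left(1- \frac{\eta}{2\varepsilon}\right)}\,\Delta_0\,(1-q)^n.$$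
   Context: Fix $d\ge 1$ and $\varepsilon>0$. $B_r(x)\subset\mathbb{R}^d$ is the open ball of center $x$ and radius $r>0$. $P$ and $Q$ are probability measures on $\mathbb{R}^d$ such that: $P$ has convex, compact support $\Omega$ and a density $\rho=dP/d\mathcal{L}_d$ with respect to Lebesgue measure $\mathcal{L}_d$ with $\lambda_P\le\rho(x)\le\Lambda_P$ for all $x\in\Omega$, for constants $0<\lambda_P<\Lambda_P<\infty$; $Q$ has compact support $\Omega'$. The cost $c:\mathbb{R}^d\times\mathbb{R}^d\to\mathbb{R}$ is Lipschitz with constant $L>0$. $\delta_P\in(0,1]$ is a constant (it exists and depends only on $\Omega$ and $\lambda_P$) such that $P(B_r(x))\ge\delta_P\min(r^d,1)$ for all $r>0$, $x\in\Omega$. Set $$\gamma_\varepsilon= 16 \left(\delta_P^{-1}\max\left( \frac{8L}{\varepsilon},1\right)^d\right) \frac{\Lambda_P^2}{\lambda_P^2}\,\frac{\bigl(\lceil 8L\,\mathrm{diam}(\Omega)/\varepsilon \rceil\bigr)^{d+2}}{\inf_{y\in\Omega'} Q\bigl(B_{\frac{\varepsilon}{8L}}(y)\bigr)}.$$ With $\Pi(P,Q)$ the set of couplings of $(P,Q)$, $$\mathrm{QOT}_\varepsilon(P,Q):=\inf_{\pi\in\Pi(P,Q)}\int c\,d\pi+\frac{\varepsilon}{2}\left\|\frac{d\pi}{d(P\otimes Q)}\right\|^2_{L^2(P\otimes Q)},$$ the last term being $+\infty$ if $\pi\not\ll P\otimes Q$. The dual objective $\Gamma:L^2(P)\times L^2(Q)\to\mathbb{R}$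 is $$\Gamma(f,g):=\int\Big(f(x)+g(y)-\frac{1}{2\varepsilon}\big(f(x)+g(y)-c(x,y)\big)_+^2\Big)\,d(P\otimes Q)(x,y),$$ where $(t)_+=\max(t,0)$. The components of its gradient are $$\mathrm{D}_1\Gamma(f,g)(x)=1-\frac1\varepsilon\int (f(x)+g(y)-c(x,y))_+\,dQ(y),\qquad \mathrm{D}_2\Gamma(f,g)(y)=1-\frac1\varepsilon\int (f(x)+g(y)-c(x,y))_+\,dP(x),$$ evaluated for $x\in\Omega$, $y\in\Omega'$. Write $(f\oplus g)(x,y):=f(x)+g(y)$. Known facts: strong duality $\mathrm{QOT}_\varepsilon(P,Q)=\sup_{L^2(P)\times L^2(Q)}\Gamma$ holds; maximizers of $\Gamma$ exist and are unique up to $(f_*+a,g_*-a)$, $a\in\mathbb{R}$. The potentials $(f_*,g_* )$ are a fixed (arbitrary) maximizer, with versions $f_*:\Omega\to\mathbb{R}$, $g_*:\Omega'\to\mathbb{R}$ that are $L$-Lipschitz; they satisfy $\int (f_*(x)+g_*(y)-c(x,y))_+dQ(y)=\varepsilon$ for all $x\in\Omega$ and $\int (f_*(x)+g_*(y)-c(x,y))_+dP(x)=\varepsilon$ for all $y\in\Omega'$. $L^\infty(\Omega)$, $L^\infty(\Omega')$ are the spaces of bounded measurable functions, and $\|\cdot\|_\infty$ is the sup norm (on $\Omega$, $\Omega'$ or $\Omega\times\Omega'$). *)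

(* Defs.v *)
From HB Require Import structures.
From mathcomp Require Import all_boot all_order all_algebra.
From mathcomp Require Import all_classical all_reals all_analysis.
From mathcomp Require Import measurable_realfun.

Set Implicit Arguments.
Unset Strict Implicit.
Unset Printing Implicit Defensive.

Import Order.TTheory GRing.Theory Num.Theory.
Import numFieldTopology.Exports numFieldNormedType.Exports.

Local Open Scope classical_set_scope.
Local Open Scope ring_scope.

Section measurable_rV.
Variables (R : realType) (d : nat).

Let coord (i : 'I_d) (x : 'rV[R]_d) : R := x ord0 i.

Let rV_set0 : g_sigma_preimage coord set0.
Proof. exact: sigma_algebra0. Qed.

Let rV_setC A : g_sigma_preimage coord A -> g_sigma_preimage coord (~` A).
Proof. exact: sigma_algebraC. Qed.

Let rV_bigcup (F : (set 'rV[R]_d)^nat) :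
  (forall i, g_sigma_preimage coord (F i)) ->
  g_sigma_preimage coord (\bigcup_i (F i)).
Proof. exact: sigma_algebra_bigcup. Qed.

(* The sigma-algebra on R^d generated by the coordinates, as the library does
   for tuples; it is the Borel sigma-algebra, see [measurable_rVE]. *)
HB.instance Definition _ :=
  @isMeasurable.Build default_measure_display 'rV[R]_d
    (g_sigma_preimage coord) rV_set0 rV_setC rV_bigcup.

Lemma measurable_coord (i : 'I_d) :
  measurable_fun setT (fun x : 'rV[R]_d => x ord0 i).
Proof.
move=> _ Y mY; rewrite setTI; apply: sub_sigma_algebra => /=.
rewrite -bigcup_seq/=; exists i => /=; first by rewrite mem_index_enum.
by exists Y => //; rewrite setTI.
Qed.

Lemma measurable_fun_coordP (d1 : measure_display) (T : measurableType d1)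
    (f : T -> 'rV[R]_d) :
  (forall i, measurable_fun setT (fun t => f t ord0 i)) -> measurable_fun setT f.
Proof.
move=> mf; apply: (@measurability _ _ _ _ _ _
  (\big[setU/set0]_(i < d) preimage_set_system setT (coord i) measurable)) => //.
move=> _ [A + <-]; rewrite -bigcup_seq/= => -[i _ [B mB <-]].
rewrite setTI; have := mf i measurableT B mB; rewrite setTI.
by rewrite setTI.
Qed.

End measurable_rV.

Section borel_rV.
Variables (R : realType) (d : nat).

Let cube (qk : 'rV[rat]_d * nat) : set 'rV[R]_d :=
  [set x | forall i, `|(ratr (qk.1 ord0 i) : R) - x ord0 i| < qk.2.+1%:R^-1].

Let measurable_cube qk : measurable (cube qk).
Proof.
rewrite (_ : cube qk = \bigcap_(i in [set: 'I_d])
    (fun x : 'rV[R]_d => x ord0 i) @^-1`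
      ball (ratr (qk.1 ord0 i) : R) (qk.2.+1%:R)^-1); last first.
  by apply/seteqP; split=> x /= qx i; [move=> _|]; exact: qx.
apply: fin_bigcap_measurable; first exact: finite_finset.
move=> i _; rewrite -[X in measurable X]setTI.
by apply: measurable_coord => //; apply: open_measurable; exact: ball_open.
Qed.

Let open_measurable_rV (U : set 'rV[R]_d) : open U -> measurable U.
Proof.
move=> oU.
rewrite (_ : U = \bigcup_(qk in [set: 'rV[rat]_d * nat])
    (if `[< cube qk `<=` U >] then cube qk else set0)).
  apply: countable_bigcupT_measurable => [|qk]; first exact: countableP.
  by case: ifPn.
apply/seteqP; split=> [x Ux|x [qk _]]; last by case: asboolP => // + cx; exact.
have /nbhs_ballP[e /= e0 eU] : nbhs x U by exact: open_nbhs_nbhs.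
have e20 : 0 < e / 2 by rewrite divr_gt0.
have [k _ /(_ k (leqnn k)) /= ke] := near_infty_natSinv_lt (PosNum e20).
have k0 : 0 < (k.+1%:R : R)^-1 by rewrite invr_gt0.
have qP i : {q : rat | `|(ratr q : R) - x ord0 i| < k.+1%:R^-1}.
  apply: cid.
  have /rat_in_itvoo[q] : x ord0 i - k.+1%:R^-1 < x ord0 i + k.+1%:R^-1.
    by rewrite ltrBlDr -addrA ltrDl addr_gt0.
  by rewrite in_itv/= => qx; exists q; rewrite ltr_distl.
exists (\row_i sval (qP i), k) => //; rewrite asboolT.
  by move=> i /=; rewrite mxE; exact: (svalP (qP i)).
move=> y /= yk; apply: eU; split=> // i j; rewrite (ord1 i) /ball/=.
have := yk j; have := svalP (qP j); rewrite mxE => qx qy.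
rewrite (le_lt_trans (ler_distD (ratr (sval (qP j))) _ _))// (splitr e).
by rewrite ltrD// (lt_trans _ ke)// distrC.
Qed.

Lemma measurable_rVE :
  @measurable _ 'rV[R]_d = <<s [set U : set 'rV[R]_d | open U] >>.
Proof.
rewrite eqEsubset; split; last first.
  apply: smallest_sub; first exact: sigma_algebra_measurable.
  by move=> U /= oU; exact: open_measurable_rV.
apply: smallest_sub; first exact: smallest_sigma_algebra.
move=> A; rewrite -bigcup_seq/= => -[i _ [B mB <-]].
pose aT := g_sigma_algebraType [set U : set 'rV[R]_d | open U].
suff : measurable_fun [set: aT] (fun x : aT => (x : 'rV[R]_d) ord0 i).
  by move=> /(_ measurableT B mB).
apply: (measurability _ (@RGenOpens.measurableE R)).
move=> _ [_ [a [b ->]] <-]; rewrite setTI; apply: sub_sigma_algebra => /=.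
apply: open_comp; last exact: interval_open.
by move=> x _; exact: coord_continuous.
Qed.

End borel_rV.

Section lebesgue_rV.
Variable R : realType.
Local Open Scope ereal_scope.

Definition cons_rV n (p : measurableTypeR R * 'rV[R]_n) : 'rV[R]_n.+1 :=
  row_mx (\row_(_ < 1) p.1) p.2.

Lemma measurable_cons_rV n : measurable_fun setT (@cons_rV n).
Proof.
apply: measurable_fun_coordP => i; rewrite /cons_rV.
under eq_fun do rewrite mxE.
case: splitP => j _.
  by under eq_fun do rewrite mxE; exact: measurable_fst.
exact: (measurableT_comp (measurable_coord j) measurable_snd).
Qed.

HB.instance Definition _ n :=
  isMeasurableFun.Build _ _ _ _ (@cons_rV n) (@measurable_cons_rV n).

Section lebesgue_cons.
Variables (n : nat) (mu : {measure set 'rV[R]_n -> \bar R}).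

(* The image of the product of the Lebesgue measure on R with [mu]; [\x^] and
   not [\x], because the latter is only a measure for sigma-finite [mu]. *)
Definition lebesgue_cons : set 'rV[R]_n.+1 -> \bar R :=
  pushforward (lebesgue_measure \x^ mu) (@cons_rV n).

Let lebesgue_cons0 : lebesgue_cons set0 = 0.
Proof. exact: measure0. Qed.

Let lebesgue_cons_ge0 A : 0 <= lebesgue_cons A.
Proof. exact: measure_ge0. Qed.

Let lebesgue_cons_sigma_additive : semi_sigma_additive lebesgue_cons.
Proof. exact: measure_semi_sigma_additive. Qed.

HB.instance Definition _ := isMeasure.Build _ _ _ lebesgue_cons
  lebesgue_cons0 lebesgue_cons_ge0 lebesgue_cons_sigma_additive.

End lebesgue_cons.

Fixpoint lebesgue_rV n : {measure set 'rV[R]_n -> \bar R} :=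
  match n with
  | 0%N => dirac (0%R : 'rV[R]_0)
  | m.+1 => lebesgue_cons (lebesgue_rV m)
  end.

Lemma lebesgue_rV_box n (A : 'I_n -> set (measurableTypeR R)) :
  (forall i, measurable (A i)) ->
  lebesgue_rV n [set x | forall i, A i (x ord0 i)] =
  \prod_(i < n) lebesgue_measure (A i).
Proof.
elim: n A => [|n IHn] A mA.
  by rewrite big_ord0 /= diracE mem_set//=; case.
have mA' : measurable [set x : 'rV[R]_n | forall i, A (lift ord0 i) (x ord0 i)].
  rewrite (_ : [set x | _] = \bigcap_(i in [set: 'I_n])
      (fun x : 'rV[R]_n => x ord0 i) @^-1` A (lift ord0 i)); last first.
    by apply/seteqP; split=> [x Ax i _|x Ax i]; exact: Ax.
  apply: fin_bigcap_measurable; first exact: finite_finset.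
  move=> i _; rewrite -[X in measurable X]setTI.
  by apply: measurable_coord => //; exact: mA.
rewrite big_ord_recl -IHn//= /lebesgue_cons /pushforward -product_measure2E//.
congr (_ _); apply/seteqP; split=> -[t y] /=.
  move=> Aty; split=> [|i].
    by have := Aty ord0; rewrite /cons_rV mxE; case: splitP => // j _; rewrite mxE.
  have := Aty (lift ord0 i); rewrite /cons_rV mxE; case: splitP => //= j.
    by rewrite ord1.
  by move=> [/ord_inj ->].
move=> [At Ay] i; rewrite /cons_rV mxE; case: splitP => j ij.
  rewrite mxE/= (_ : i = ord0)//; apply: val_inj => /=.
  by rewrite ij ord1.
by have := Ay j; rewrite (_ : lift ord0 j = i)//; exact: val_inj.
Qed.

End lebesgue_rV.

Section euclidean.
Variables (R : realType) (d : nat).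
Implicit Types (x y : 'rV[R]_d) (A : set 'rV[R]_d).

(* The library's norm and balls on 'rV[R]_d are those of the sup norm. *)
Definition enorm x : R := Num.sqrt (\sum_(i < d) x ord0 i ^+ 2).

Definition eball x (r : R) : set 'rV[R]_d := [set y | enorm (y - x) < r].

Definition ediam A : R := sup [set enorm (x - y) | x in A & y in A].

Definition elipschitz_on A (L : R) (f : 'rV[R]_d -> R) :=
  forall x y, A x -> A y -> `|f x - f y| <= L * enorm (x - y).

(* Lipschitz for the Euclidean norm of R^d * R^d = R^{2d}. *)
Definition elipschitz2 (L : R) (c : 'rV[R]_d -> 'rV[R]_d -> R) :=
  forall x y x' y', `|c x y - c x' y'| <=
    L * Num.sqrt (enorm (x - x') ^+ 2 + enorm (y - y') ^+ 2).

Definition supp (mu : {measure set 'rV[R]_d -> \bar R}) : set 'rV[R]_d :=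
  [set x | forall r : R, 0 < r -> (0 < mu (eball x r))%E].

Definition is_density (P : probability 'rV[R]_d R) (rho : 'rV[R]_d -> R) :=
  [/\ measurable_fun setT rho, (forall x, 0 <= rho x) &
    forall A, measurable A -> P A = (\int[lebesgue_rV R d]_(x in A) (rho x)%:E)%E].

End euclidean.

Section sup_norm.
Variables (R : realType) (T : Type).

Definition supnorm (A : set T) (h : T -> R) : \bar R :=
  ereal_sup [set `|h x|%:E | x in A].

End sup_norm.

Definition oplus (R : realType) (T U : Type) (f : T -> R) (g : U -> R)
  (z : T * U) : R := f z.1 + g z.2.

Local Open Scope charge_scope.

(* The squared L^2(mu) norm of the density of [nu] with respect to [mu]. *)
Definition sqnorm_density (d : measure_display) (T : measurableType d)
    (R : realType) (nu mu : probability T R) : \bar R :=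
  if `[< nu `<< mu >] then
    ('N[mu]_2%:E['d (charge_of_finite_measure nu) '/d mu] ^+ 2)%E
  else +oo%E.

Local Close Scope charge_scope.

Section quadratic_ot.
Variables (R : realType) (d : nat).
Local Notation Rd := ('rV[R]_d).
Variables (P Q : probability Rd R) (c : Rd -> Rd -> R) (eps : R).

Definition is_coupling (pi : probability (Rd * Rd)%type R) :=
  forall A : set Rd, measurable A ->
    pi (A `*` setT) = P A /\ pi (setT `*` A) = Q A.

Local Open Scope ereal_scope.

Definition QOT : \bar R :=
  ereal_inf [set \int[pi]_z (c z.1 z.2)%:E
                 + (eps / 2)%:E * sqnorm_density pi (P \x Q) |
             pi in is_coupling].

Local Close Scope ereal_scope.

(* Potentials are only meaningful on the supports, so all the integrals below
   are restricted to them; this does not change their values. *)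
Definition Gamma (f g : Rd -> R) : R :=
  \int[(P \x Q)%E]_(z in supp P `*` supp Q)
    (oplus f g z
     - (2 * eps)^-1 * Num.max (oplus f g z - c z.1 z.2) 0 ^+ 2).

Definition D1Gamma (f g : Rd -> R) (x : Rd) : R :=
  1 - eps^-1 * \int[Q]_(y in supp Q) Num.max (f x + g y - c x y) 0.

Definition D2Gamma (f g : Rd -> R) (y : Rd) : R :=
  1 - eps^-1 * \int[P]_(x in supp P) Num.max (f x + g y - c x y) 0.

Definition L2_supp (mu : probability Rd R) (f : Rd -> R) :=
  f \_ (supp mu) \in Lfun mu 2%:E.

Definition Linfty_supp (mu : probability Rd R) (f : Rd -> R) :=
  measurable_fun (supp mu) f /\ [bounded f x | x in supp mu].

Definition is_maximizer (fs gs : Rd -> R) :=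
  [/\ L2_supp P fs, L2_supp Q gs &
    forall f g, L2_supp P f -> L2_supp Q g -> Gamma f g <= Gamma fs gs].

Definition gradient_ascent (eta : R) (f g : nat -> Rd -> R) :=
  forall n,
    (forall x, supp P x ->
      f n.+1 x = f n x + eta * D1Gamma (f n) (g n) x) /\
    (forall y, supp Q y ->
      g n.+1 y = g n y + eta * D2Gamma (f n.+1) (g n) y).

Definition gamma_eps (L deltaP lambdaP LambdaP : R) : R :=
  16 * (deltaP^-1 * Num.max (8 * L / eps) 1 ^+ d)
  * (LambdaP ^+ 2 / lambdaP ^+ 2)
  * ((Num.ceil (8 * L * ediam (supp P) / eps))%:~R ^+ (d + 2)
     / fine (ereal_inf [set Q (eball y (eps / (8 * L))) | y in supp Q])).

End quadratic_ot.

(* Main.v *)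
Require Import Defs.
From HB Require Import structures.
From mathcomp Require Import all_boot all_order all_algebra.
From mathcomp Require Import all_classical all_reals all_analysis.
From mathcomp Require Import measurable_realfun ring lra.

(**
Write h = f + g - fs - gs for the error, s for the positive part of f + g - c,
and s0 for its value at the optimum.

The rate comes from a gradient domination inequality, gap <= k * |DGamma|^2 with
k = gamma * M. By concavity the gap is at most the slope G = - DGamma(f, g).h,
which equals the integral of (s - s0) h / eps since DGamma(fs, gs) = 0
([gap_le_slope], [slopeE]). The integrand is nonnegative, and it dominates a
multiple of h^2 wherever fs + gs - c >= 9/16 eps. This set is large: each point
x of the support of P has a partner y in that of Q with fs + gs - c close to eps,
because the optimal s0 has conditional mean eps, and the Lipschitz bounds give a
product of balls of radius eps / (8 L) around (x, y) ([contact_near]). As h is a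
sum a(x) + b(y), controlling h^2 on these products controls it everywhere: the
differences a(x) - a(x') at distance eps / (8 L) are controlled directly, and one
chains along segments in the convex support of P, the bounds on the density
ensuring that the measure is not distorted too much ([poincare],
[Rintegral_contraction]). Hence the integral of h^2 is at most k * G
([quadratic_growth]); with G <= |DGamma| |h|, after the shift by a constant that
makes the two components of h orthogonal, this gives G <= k |DGamma|^2 and
|h|^2 <= k^2 |DGamma|^2 ([polyak]).

Each sweep increases Gamma by at least eta (1 - eta / (2 eps)) |DGamma|^2 / 2
([Gamma_sweep]), so the gap is multiplied by at most 1 - q.

The constant M must be valid along the iteration. An ascent step moves f - fs and
gs - g by averaging, so any interval containing the values of both is preserved
([step1_bounds], [step2_bounds]). A symmetric interval gives the monotonicity of
the sup norms. An interval of length 2 |h_0| gives |h_n| <= 2 |h_0| <= M; the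
norm of h_n itself need not decrease.

Finally the gap is measured from the primal value, which equals Gamma(fs, gs) by
strong duality ([QOT_dual]): the optimal coupling has density s0 / eps.
*)

Set Implicit Arguments.
Unset Strict Implicit.
Unset Printing Implicit Defensive.

Import Order.TTheory GRing.Theory Num.Theory.
Import numFieldTopology.Exports numFieldNormedType.Exports.

Local Open Scope classical_set_scope.
Local Open Scope ring_scope.

(** * Bounded measurable functions *)

Lemma probability_setI1 (R : realType) d (T : measurableType d)
    (P : probability T R) (A D : set T) :
  measurable A -> measurable D -> P D = 1%E -> P (A `&` D) = P A.
Proof.
move=> mA mD PD; rewrite [RHS](measureDI P mA mD).
rewrite [X in _ = (X + _)%E](_ : _ = 0%E) ?add0e//.
apply/eqP; rewrite -measure_le0.
have <- : P (~` D) = 0%E by rewrite probability_setC// PD subee.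
apply: le_measure; rewrite ?inE; [exact: measurableD|exact: measurableC|].
by move=> x [].
Qed.


(** Bounded measurable functions on D; only the values on D matter, so that a
    potential need not be specified outside the support of its marginal. *)
Definition bmeas (R : realType) d (T : measurableType d) (D : set T)
    (f : T -> R) :=
  measurable_fun D f /\ exists M, forall x, D x -> `|f x| <= M.

Section bmeas.
Context (R : realType) d (T : measurableType d) (D : set T).
Implicit Types (f g : T -> R).

Lemma eq_bmeas f g : (forall x, D x -> f x = g x) -> bmeas D f -> bmeas D g.
Proof.
move=> fg [mf [M fM]]; split.
  by apply: eq_measurable_fun mf => x; rewrite inE => /fg.
by exists M => x Dx; rewrite -fg// fM.
Qed.

Lemma bmeas_cst (k : R) : bmeas D (fun=> k).
Proof. by split; [exact: measurable_cst|exists `|k|]. Qed.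

Lemma bmeasD f g : bmeas D f -> bmeas D g -> bmeas D (fun x => f x + g x).
Proof.
move=> [mf [M fM]] [mg [N gN]]; split; first exact: measurable_funD.
by exists (M + N) => x Dx; rewrite (le_trans (ler_normD _ _))// lerD ?fM ?gN.
Qed.

Lemma bmeasN f : bmeas D f -> bmeas D (fun x => - f x).
Proof.
move=> [mf [M fM]]; split; first exact: measurable_funN.
by exists M => x Dx; rewrite normrN fM.
Qed.

Lemma bmeasB f g : bmeas D f -> bmeas D g -> bmeas D (fun x => f x - g x).
Proof. by move=> mf mg; apply: bmeasD => //; exact: bmeasN. Qed.

Lemma bmeasM f g : bmeas D f -> bmeas D g -> bmeas D (fun x => f x * g x).
Proof.
move=> [mf [M fM]] [mg [N gN]]; split; first exact: measurable_funM.
by exists (M * N) => x Dx; rewrite normrM ler_pM ?fM ?gN.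
Qed.

Lemma bmeasZ (k : R) f : bmeas D f -> bmeas D (fun x => k * f x).
Proof. by apply: bmeasM; exact: bmeas_cst. Qed.

Lemma bmeasX f n : bmeas D f -> bmeas D (fun x => f x ^+ n).
Proof.
move=> [mf [M fM]]; split; first exact: measurable_funX.
by exists (M ^+ n) => x Dx; rewrite normrX lerXn2r ?nnegrE ?fM// (le_trans _ (fM _ Dx)).
Qed.

Lemma bmeas_max0 f : bmeas D f -> bmeas D (fun x => Num.max (f x) 0).
Proof.
move=> [mf [M fM]]; split.
  exact: (measurable_maxr mf (measurable_cst _)).
exists M => x Dx; have := fM _ Dx; have := normr_ge0 (f x).
by rewrite maxC /Num.max; case: ifPn => //; rewrite normr0; lra.
Qed.

Lemma bmeas_sum n (h : nat -> T -> R) :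
  (forall i, (i < n)%N -> bmeas D (h i)) -> bmeas D (fun x => \sum_(i < n) h i x).
Proof.
elim: n => [|n IHn] bh.
  by apply: (eq_bmeas _ (bmeas_cst 0)) => x _; rewrite big_ord0.
apply: (@eq_bmeas (fun x => \sum_(i < n) h i x + h n x)).
  by move=> x _; rewrite big_ord_recr.
by apply: bmeasD; [apply: IHn => i iltn; exact/bh/ltnW|exact: bh].
Qed.

End bmeas.

Section bmeas_integral.
Context (R : realType) d (T : measurableType d) (P : probability T R) (D : set T).
Hypothesis mD : measurable D.
Implicit Types (f g : T -> R).

Lemma bmeas_integrable f : bmeas D f -> P.-integrable D (EFin \o f).
Proof.
move=> [mf [M fM]]; apply: (le_integrable mD _ _ (_ : P.-integrable D (EFin \o cst `|M|))).
- exact/measurable_EFinP.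
- by move=> x Dx /=; rewrite lee_fin normr_id (le_trans (fM x Dx))// ler_norm.
- apply: finite_measure_integrable_cst => //.
Qed.

Lemma EFin_RintegralE f : bmeas D f ->
  (\int[P]_(x in D) (f x)%:E)%E = (\int[P]_(x in D) f x)%:E.
Proof. by move=> bf; rewrite /Rintegral fineK// integrable_fin_num//; exact: bmeas_integrable. Qed.

Lemma bRintegralD f g : bmeas D f -> bmeas D g ->
  \int[P]_(x in D) (f x + g x) = \int[P]_(x in D) f x + \int[P]_(x in D) g x.
Proof. by move=> bf bg; rewrite RintegralD//; exact: bmeas_integrable. Qed.

Lemma bRintegralB f g : bmeas D f -> bmeas D g ->
  \int[P]_(x in D) (f x - g x) = \int[P]_(x in D) f x - \int[P]_(x in D) g x.
Proof. by move=> bf bg; rewrite RintegralB//; exact: bmeas_integrable. Qed.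

Lemma bRintegralZ k f : bmeas D f ->
  \int[P]_(x in D) (k * f x) = k * \int[P]_(x in D) f x.
Proof. by move=> bf; rewrite RintegralZl//; exact: bmeas_integrable. Qed.

Lemma bRintegralN f : bmeas D f ->
  \int[P]_(x in D) (- f x) = - \int[P]_(x in D) f x.
Proof.
move=> bf; rewrite -mulN1r -bRintegralZ//.
by apply: eq_Rintegral => x _; rewrite mulN1r.
Qed.

Lemma bRintegral_sum n (h : nat -> T -> R) :
  (forall i, (i < n)%N -> bmeas D (h i)) ->
  \int[P]_(x in D) (\sum_(i < n) h i x) = \sum_(i < n) \int[P]_(x in D) h i x.
Proof.
elim: n => [|n IHn] bh.
  rewrite big_ord0 (_ : (fun _ => _) = fun=> 0) ?Rintegral_cst ?mul0r//.
  by apply/funext => x; rewrite big_ord0.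
under eq_Rintegral do rewrite big_ord_recr /=.
have bh' i : (i < n)%N -> bmeas D (h i) by move=> iltn; exact/bh/ltnW.
by rewrite bRintegralD ?big_ord_recr ?IHn//; [exact: bmeas_sum|exact: bh].
Qed.

Lemma ler_bRintegral f g : bmeas D f -> bmeas D g ->
  (forall x, D x -> f x <= g x) ->
  \int[P]_(x in D) f x <= \int[P]_(x in D) g x.
Proof. by move=> bf bg fg; apply: le_Rintegral => //; exact: bmeas_integrable. Qed.

Lemma eq_bRintegral f g : (forall x, D x -> f x = g x) ->
  \int[P]_(x in D) f x = \int[P]_(x in D) g x.
Proof. by move=> fg; apply: eq_Rintegral => x; rewrite inE => /fg. Qed.

(** Markov's inequality. *)
Lemma markov_Rintegral f k (B : set T) : bmeas D f -> (forall x, D x -> 0 <= f x) ->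
  measurable B -> (forall x, D x -> B x -> k <= f x) ->
  k * fine (P (D `&` B)) <= \int[P]_(x in D) f x.
Proof.
move=> bf f0 mB kf.
rewrite -Rintegral_cst ?Rintegral_mkcondr; last exact: measurableI.
apply: ler_bRintegral => //.
  split; first by apply/measurable_restrict => //; exact: measurable_cst.
  by exists `|k| => x Dx; rewrite patchE; case: ifP => //; rewrite normr0.
move=> x Dx; rewrite patchE; case: ifPn; last by rewrite f0.
by rewrite inE; exact: kf.
Qed.

Hypothesis PD : P D = 1%E.

Lemma Rintegral_cst1 k : \int[P]_(_ in D) k = k.
Proof. by rewrite Rintegral_cst// (_ : fine _ = 1) ?mulr1// -[RHS]/(fine 1%E) -PD. Qed.

Lemma Rintegral_lb f k : bmeas D f -> (forall x, D x -> k <= f x) ->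
  k <= \int[P]_(x in D) f x.
Proof.
move=> bf kf; apply: le_trans (_ : \int[P]_(_ in D) k <= _).
  by rewrite Rintegral_cst1.
by apply: ler_bRintegral => //; exact: bmeas_cst.
Qed.

Lemma Rintegral_ub f k : bmeas D f -> (forall x, D x -> f x <= k) ->
  \int[P]_(x in D) f x <= k.
Proof.
move=> bf kf; apply: (le_trans (_ : _ <= \int[P]_(_ in D) k)); last first.
  by rewrite Rintegral_cst1.
by apply: ler_bRintegral => //; exact: bmeas_cst.
Qed.

(** Jensen's inequality for the square. *)
Lemma Rintegral_sqr_le f : bmeas D f ->
  (\int[P]_(x in D) f x) ^+ 2 <= \int[P]_(x in D) (f x ^+ 2).
Proof.
move=> bf; set m := \int[P]_(x in D) f x.
have : 0 <= \int[P]_(x in D) ((f x - m) ^+ 2).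
  by apply: Rintegral_ge0 => x _; exact: sqr_ge0.
have bf2 := bmeasX 2 bf; have bZ := bmeasZ (2 * m) bf.
rewrite (@eq_bRintegral _ (fun x => (f x ^+ 2 - 2 * m * f x) + m ^+ 2)); last by move=> x _; ring.
rewrite bRintegralD//; [|exact: bmeasB|exact: bmeas_cst].
rewrite bRintegralB// bRintegralZ// Rintegral_cst1 -/m; lra.
Qed.

End bmeas_integral.

Section bmeas_fubini.
Context (R : realType) d1 d2 (T1 : measurableType d1) (T2 : measurableType d2)
  (P : probability T1 R) (Q : probability T2 R) (D1 : set T1) (D2 : set T2).
Hypotheses (mD1 : measurable D1) (mD2 : measurable D2).
Implicit Types f : T1 * T2 -> R.

Let mD : measurable (D1 `*` D2). Proof. exact: measurableX. Qed.

Lemma bmeas_fst (f : T1 -> R) : bmeas D1 f ->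
  bmeas (D1 `*` D2) (fun z => f z.1).
Proof.
move=> [mf [M fM]]; split; last by exists M => z [/fM].
move=> _ Y mY; rewrite (_ : _ `&` _ = (D1 `&` f @^-1` Y) `*` D2); last first.
  by apply/seteqP; split=> [[x y] [[? ?] ?]|[x y] [[? ?] ?]].
by apply: measurableX => //; exact: mf.
Qed.

Lemma bmeas_snd (g : T2 -> R) : bmeas D2 g ->
  bmeas (D1 `*` D2) (fun z => g z.2).
Proof.
move=> [mf [M fM]]; split; last by exists M => z [_ /fM].
move=> _ Y mY; rewrite (_ : _ `&` _ = D1 `*` (D2 `&` g @^-1` Y)); last first.
  by apply/seteqP; split=> [[x y] [[? ?] ?]|[x y] [? [? ?]]].
by apply: measurableX => //; exact: mf.
Qed.

Lemma bmeas_sectionl f x : D1 x -> bmeas (D1 `*` D2) f ->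
  bmeas D2 (fun y => f (x, y)).
Proof.
move=> D1x [mf [M fM]]; split; last by exists M => y D2y; exact: fM.
move=> _ Y mY.
rewrite (_ : _ `&` _ = xsection ((D1 `*` D2) `&` f @^-1` Y) x).
  by apply: measurable_xsection; exact: mf.
by apply/seteqP; split=> y; [move=> [? ?]; exact/xsectionP|move/xsectionP => [[]]].
Qed.

Lemma bmeas_sectionr f y : D2 y -> bmeas (D1 `*` D2) f ->
  bmeas D1 (fun x => f (x, y)).
Proof.
move=> D1x [mf [M fM]]; split; last by exists M => x D2y; exact: fM.
move=> _ Y mY.
rewrite (_ : _ `&` _ = ysection ((D1 `*` D2) `&` f @^-1` Y) y).
  by apply: measurable_ysection; exact: mf.
by apply/seteqP; split=> x; [move=> [? ?]; exact/ysectionP|move/ysectionP => [[]]].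
Qed.

Let restrict_integrable f : bmeas (D1 `*` D2) f ->
  (P \x Q)%E.-integrable setT (EFin \o (f \_ (D1 `*` D2))).
Proof.
move=> bf; rewrite -restrict_EFin; apply/integrable_restrict => //.
by rewrite setTI; exact: bmeas_integrable.
Qed.

(** Fubini's theorem for bounded measurable functions on a rectangle, together
    with the regularity of the inner integral. *)
Lemma bRintegral_prodl f : bmeas (D1 `*` D2) f ->
  bmeas D1 (fun x => \int[Q]_(y in D2) f (x, y)) /\
  \int[(P \x Q)%E]_(z in D1 `*` D2) f z =
  \int[P]_(x in D1) \int[Q]_(y in D2) f (x, y).
Proof.
move=> bf; have iF := restrict_integrable bf.
have FE x : fubini_F Q (EFin \o (f \_ (D1 `*` D2))) x =
    ((fun x => (\int[Q]_(y in D2) f (x, y)))%R \_ D1 x)%:E.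
  rewrite /fubini_F /= patchE; case: ifPn => xD1; last first.
    by apply: integral0_eq => y _; rewrite patchE ifN//; apply: contraNN xD1; rewrite !inE; case.
  rewrite -EFin_RintegralE//; last by apply: bmeas_sectionl => //; exact/set_mem.
  rewrite [RHS]integral_mkcond; apply: eq_integral => y _; rewrite !patchE.
  have -> : ((x, y) \in D1 `*` D2) = (y \in D2).
    by apply/idP/idP; rewrite !inE; [case|move=> D2y; split => //; exact/set_mem].
  by case: ifP.
split.
  split.
    apply/(measurable_restrictT _ mD1)/measurable_EFinP.
    rewrite (_ : _ \o _ = fubini_F Q (EFin \o (f \_ (D1 `*` D2)))).
      exact: measurable_fubini_F iF.
    by apply/funext => x; rewrite FE.
  have [_ [M fM]] := bf; exists `|M| => x D1x.
  have bfx := bmeas_sectionl D1x bf.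
  apply: (le_trans (le_normr_Rintegral mD2 (bmeas_integrable Q mD2 bfx))).
  rewrite (le_trans (_ : _ <= \int[Q]_(y in D2) `|M|))//.
    apply: ler_bRintegral => //; first last.
    - by move=> y D2y; rewrite (le_trans (fM (x, y) _))// ler_norm.
    - exact: bmeas_cst.
    split; first by apply: measurableT_comp => //; case: bfx.
    by exists M => y D2y; rewrite normr_id; exact: fM.
  rewrite Rintegral_cst// ler_piMr// -lee_fin fineK ?fin_num_measure//.
  exact: probability_le1.
rewrite [RHS]Rintegral_mkcond [LHS]Rintegral_mkcond /Rintegral; congr fine.
rewrite -integral12_prod_meas1//.
by apply: eq_integral => x _; rewrite FE.
Qed.

Lemma bRintegral_prodr f : bmeas (D1 `*` D2) f ->
  bmeas D2 (fun y => \int[P]_(x in D1) f (x, y)) /\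
  \int[(P \x Q)%E]_(z in D1 `*` D2) f z =
  \int[Q]_(y in D2) \int[P]_(x in D1) f (x, y).
Proof.
move=> bf; have iF := restrict_integrable bf.
have FE y : fubini_G P (EFin \o (f \_ (D1 `*` D2))) y =
    ((fun y => (\int[P]_(x in D1) f (x, y)))%R \_ D2 y)%:E.
  rewrite /fubini_G /= patchE; case: ifPn => yD; last first.
    by apply: integral0_eq => x _; rewrite patchE ifN//; apply: contraNN yD; rewrite !inE; case.
  rewrite -EFin_RintegralE//; last by apply: bmeas_sectionr => //; exact/set_mem.
  rewrite [RHS]integral_mkcond; apply: eq_integral => x _; rewrite !patchE.
  have -> : ((x, y) \in D1 `*` D2) = (x \in D1).
    by apply/idP/idP; rewrite !inE; [case|move=> D2y; split => //; exact/set_mem].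
  by case: ifP.
split.
  split.
    apply/(measurable_restrictT _ mD2)/measurable_EFinP.
    rewrite (_ : _ \o _ = fubini_G P (EFin \o (f \_ (D1 `*` D2)))).
      exact: measurable_fubini_G iF.
    by apply/funext => x; rewrite FE.
  have [_ [M fM]] := bf; exists `|M| => y D2y.
  have bfx := bmeas_sectionr D2y bf.
  apply: (le_trans (le_normr_Rintegral mD1 (bmeas_integrable P mD1 bfx))).
  rewrite (le_trans (_ : _ <= \int[P]_(y in D1) `|M|))//.
    apply: ler_bRintegral => //; first last.
    - by move=> x D1x; rewrite (le_trans (fM (x, y) _))// ler_norm.
    - exact: bmeas_cst.
    split; first by apply: measurableT_comp => //; case: bfx.
    by exists M => x D1x; rewrite normr_id; exact: fM.
  rewrite Rintegral_cst// ler_piMr// -lee_fin fineK ?fin_num_measure//.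
  exact: probability_le1.
rewrite [RHS]Rintegral_mkcond [LHS]Rintegral_mkcond /Rintegral; congr fine.
rewrite -integral21_prod_meas1//.
by apply: eq_integral => x _; rewrite FE.
Qed.

Hypotheses (PD1 : P D1 = 1%E) (QD2 : Q D2 = 1%E).

Lemma bRintegral_fst (f : T1 -> R) : bmeas D1 f ->
  \int[(P \x Q)%E]_(z in D1 `*` D2) f z.1 = \int[P]_(x in D1) f x.
Proof.
move=> bf; have [_ ->] := bRintegral_prodl (bmeas_fst bf).
by apply: eq_Rintegral => x _ /=; exact: (Rintegral_cst1 mD2 QD2).
Qed.

Lemma bRintegral_snd (g : T2 -> R) : bmeas D2 g ->
  \int[(P \x Q)%E]_(z in D1 `*` D2) g z.2 = \int[Q]_(y in D2) g y.
Proof.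
move=> bg; have [_ ->] := bRintegral_prodr (bmeas_snd bg).
by apply: eq_Rintegral => x _ /=; exact: (Rintegral_cst1 mD1 PD1).
Qed.

End bmeas_fubini.

(** * Euclidean geometry and supports *)

Section euclidean_geometry.
Context (R : realType) (d : nat).
Local Notation Rd := ('rV[R]_d).
Implicit Types (x y z : Rd).

Lemma enorm_ge0 x : 0 <= enorm x.
Proof. exact: sqrtr_ge0. Qed.

Lemma enormZ (k : R) x : enorm (k *: x) = `|k| * enorm x.
Proof.
rewrite /enorm -sqrtr_sqr -sqrtrM ?sqr_ge0// mulr_sumr.
by congr Num.sqrt; apply: eq_bigr => i _; rewrite mxE exprMn.
Qed.

Lemma enormN x : enorm (- x) = enorm x.
Proof. by rewrite -scaleN1r enormZ normrN1 mul1r. Qed.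

Lemma enormC x y : enorm (x - y) = enorm (y - x).
Proof. by rewrite -enormN opprB. Qed.

Lemma enorm0 : enorm (0 : Rd) = 0.
Proof. by rewrite -(scale0r (0 : Rd)) enormZ normr0 mul0r. Qed.

Lemma coord_le_enorm x i : `|x ord0 i| <= enorm x.
Proof.
rewrite -sqrtr_sqr ler_wsqrtr// (bigD1 i)//= lerDl.
by apply: sumr_ge0 => j _; exact: sqr_ge0.
Qed.

Lemma enorm_le_coord x s : 0 <= s -> (forall i, `|x ord0 i| <= s) ->
  enorm x <= d%:R * s.
Proof.
move=> s0 xs; have ds0 : 0 <= d%:R * s by rewrite mulr_ge0.
rewrite -[leRHS](ger0_norm ds0) -sqrtr_sqr ler_wsqrtr//.
apply: (@le_trans _ _ (\sum_(i < d) s ^+ 2)).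
  by apply: ler_sum => i _; rewrite -real_normK ?num_real// lerXn2r ?nnegrE.
rewrite sumr_const card_ord -[leLHS]mulr_natl exprMn; apply: ler_wpM2r; first exact: sqr_ge0.
by case: (d) => [|n]; rewrite ?expr0n// ler_eXnr// ler1n.
Qed.

Lemma rV_ballP x (s : R) y : 0 < s ->
  ball x s y <-> forall i, `|x ord0 i - y ord0 i| < s.
Proof.
move=> s0; split=> [[_ xy] i|xy]; first exact: xy.
by split=> // i j; rewrite (ord1 i); exact: xy.
Qed.

Lemma open_measurable_rV (U : set Rd) : open U -> measurable U.
Proof. by move=> oU; rewrite measurable_rVE; exact: sub_sigma_algebra. Qed.

Lemma compact_measurable_rV (A : set Rd) : compact A -> measurable A.
Proof.
move=> /compact_closed cA; rewrite -[A]setCK; apply: measurableC.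
apply: open_measurable_rV; apply: closed_openC; apply: cA.
exact: norm_hausdorff.
Qed.

Lemma measurable_enorm : measurable_fun setT (@enorm R d).
Proof.
apply: (@measurableT_comp _ _ _ _ _ _ (@Num.sqrt R)).
  by apply: continuous_measurable_fun => x; exact: sqrt_continuous.
by apply: measurable_sum => i; apply: measurable_funX; exact: measurable_coord.
Qed.

Lemma measurable_funB_rV d1 (T : measurableType d1) (f g : T -> Rd) :
  measurable_fun setT f -> measurable_fun setT g ->
  measurable_fun setT (fun t => f t - g t).
Proof.
move=> mf mg; apply: measurable_fun_coordP => i.
rewrite (_ : (fun t => _) = (fun t => f t ord0 i - g t ord0 i)); last first.
  by apply/funext => t; rewrite !mxE.
by apply: measurable_funB;
  exact: (measurableT_comp (measurable_coord i)).
Qed.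

Lemma measurable_funD_rV d1 (T : measurableType d1) (f g : T -> Rd) :
  measurable_fun setT f -> measurable_fun setT g ->
  measurable_fun setT (fun t => f t + g t).
Proof.
move=> mf mg; apply: measurable_fun_coordP => i.
rewrite (_ : (fun t => _) = (fun t => f t ord0 i + g t ord0 i)); last first.
  by apply/funext => t; rewrite !mxE.
by apply: measurable_funD;
  exact: (measurableT_comp (measurable_coord i)).
Qed.

Lemma measurable_funZ_rV d1 (T : measurableType d1) (k : R) (f : T -> Rd) :
  measurable_fun setT f -> measurable_fun setT (fun t => k *: f t).
Proof.
move=> mf; apply: measurable_fun_coordP => i.
rewrite (_ : (fun t => _) = (fun t => k * f t ord0 i)); last first.
  by apply/funext => t; rewrite !mxE.
apply: measurable_funM; first exact: measurable_cst.
exact: (measurableT_comp (measurable_coord i)).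
Qed.

Lemma measurable_eball x (r : R) : measurable (eball x r).
Proof.
rewrite -[eball x r]setTI.
rewrite (_ : eball x r = (fun y => enorm (y - x)) @^-1` [set t | t < r])//.
apply: (measurableT_comp (@measurable_enorm)) => //.
- exact: measurable_funB_rV.
- by apply: open_measurable; exact: open_lt.
Qed.

Lemma enorm_bounded (A : set Rd) : compact A ->
  exists2 M : R, 0 <= M & forall x y, A x -> A y -> enorm (x - y) <= M.
Proof.
move=> /compact_bounded[M [_ AM]].
have M1 : M < `|M| + 1 by rewrite (le_lt_trans (ler_norm _))// ltrDl.
exists (d%:R * ((`|M| + 1) + (`|M| + 1))); first by rewrite mulr_ge0// !addr_ge0.
have AMi x i : A x -> `|x ord0 i| <= `|M| + 1.
  move=> Ax; apply: le_trans (AM _ M1 _ Ax).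
  have /mapP[j Hj ->] : `|x ord0 i| \in [seq `|x z.1 z.2| | z : 'I_1 * 'I_d].
    by apply/mapP; exists (ord0, i) => //=; rewrite mem_enum.
  by rewrite [leRHS]/Num.Def.normr /= mx_normrE; apply/bigmax_geP; right => /=; exists j.
move=> x y Ax Ay; apply: enorm_le_coord; first by rewrite !addr_ge0.
by move=> i; rewrite !mxE (le_trans (ler_normB _ _))// lerD ?AMi.
Qed.

Lemma enorm_le_ediam (A : set Rd) x y : compact A -> A x -> A y ->
  enorm (x - y) <= ediam A.
Proof.
move=> cA Ax Ay; apply: ub_le_sup; last by exists x => //; exists y.
have [M _ AM] := enorm_bounded cA.
by exists M => _ [x' Ax' [y' Ay' <-]]; exact: AM.
Qed.

End euclidean_geometry.

Section support.
Context (R : realType) (d : nat).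
Local Notation Rd := ('rV[R]_d).
Variable P : probability Rd R.

(* The balls with rational centre and radius 1/(k+1), a countable basis. *)
Let qball (qk : 'rV[rat]_d * nat) : set Rd :=
  ball (map_mx ratr qk.1 : Rd) (qk.2.+1%:R^-1 : R).

Let qballP (x : Rd) (s : R) : 0 < s ->
  exists qk, qball qk x /\ qball qk `<=` ball x s.
Proof.
move=> s0; have s20 : 0 < s / 2 by rewrite divr_gt0.
have [k _ /(_ k (leqnn k)) /= ke] := near_infty_natSinv_lt (PosNum s20).
have k0 : 0 < (k.+1%:R : R)^-1 by rewrite invr_gt0.
have qP i : {q : rat | `|(ratr q : R) - x ord0 i| < k.+1%:R^-1}.
  apply: cid.
  have /rat_in_itvoo[q] : x ord0 i - k.+1%:R^-1 < x ord0 i + k.+1%:R^-1.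
    by rewrite ltrBlDr -addrA ltrDl addr_gt0.
  by rewrite in_itv/= => qx; exists q; rewrite ltr_distl.
have xq : qball (\row_i sval (qP i), k) x.
  by apply/rV_ballP => // i; rewrite !mxE; exact: (svalP (qP i)).
exists (\row_i sval (qP i), k); split => // y qy.
rewrite (splitr s); apply: ball_triangle.
  by apply: ball_sym; apply: le_ball xq; exact/ltW.
by apply: le_ball qy; exact/ltW.
Qed.

Let measurable_qball qk : measurable (qball qk).
Proof. by apply: open_measurable_rV; exact: ball_open. Qed.

Lemma supp_ball_gt0 (x : Rd) (s : R) : 0 < s -> supp P x -> (0 < P (ball x s))%E.
Proof.
move=> s0 /(_ s s0) /lt_le_trans; apply; apply: le_measure.
- by rewrite inE; exact: measurable_eball.
- by rewrite inE; apply: open_measurable_rV; exact: ball_open.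
- move=> y xy; apply/rV_ballP => // i.
  by rewrite (le_lt_trans _ xy)// (le_trans _ (coord_le_enorm _ i))// !mxE distrC.
Qed.

Lemma ball_sub_eball (x : Rd) (r : R) : 0 < r ->
  ball x (r / d.+1%:R) `<=` eball x r.
Proof.
move=> r0 y; have s0 : 0 < r / d.+1%:R by rewrite divr_gt0.
move=> /(rV_ballP _ _ s0) xy; rewrite /eball /=.
apply: (@le_lt_trans _ _ (d%:R * (r / d.+1%:R))).
  by apply: enorm_le_coord => [|i]; [exact: ltW|rewrite !mxE distrC ltW].
by rewrite mulrCA gtr_pMr// ltr_pdivrMr ?mul1r ?ltr_nat.
Qed.

(** The complement of the support is covered by countably many null balls of
    the basis. *)
Lemma probability_supp : measurable (supp P) -> P (supp P) = 1%E.
Proof.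
move=> mS.
suff : P.-negligible (~` supp P).
  move=> /(measure_negligible (measurableC mS)) PC0.
  have := probability_setC P (measurableC mS); rewrite setCK => ->.
  by rewrite PC0 sube0.
pose F (k : nat) : set Rd := if unpickle k is Some qk then
  (if `[< P (qball qk) = 0%E >] then qball qk else set0) else set0.
apply: (@negligibleS _ _ _ _ (\bigcup_k F k)); last first.
  apply: negligible_bigcup => k; rewrite /F; case: unpickle => [qk|]; last first.
    exact: negligible_set0.
  by case: asboolP => [Pk|_]; [exact/negligibleP|exact: negligible_set0].
move=> x /= /existsNP[r /not_implyP[r0 /negP]]; rewrite -leNgt => Pr0.
have [qk [qx qr]] := @qballP x (r / d.+1%:R) (divr_gt0 r0 (ltr0Sn _ _)).
exists (pickle qk) => //; rewrite /F pickleK asboolT//.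
apply/eqP; rewrite -measure_le0 (le_trans _ Pr0)//.
apply: le_measure; rewrite ?inE//; first exact: measurable_eball.
by apply: (subset_trans qr); exact: ball_sub_eball.
Qed.

Lemma supp_neq0 : measurable (supp P) -> supp P !=set0.
Proof.
move=> mS; apply/set0P/eqP => S0; have := probability_supp mS.
by rewrite S0 measure0 => /eqP; rewrite eqe eq_sym oner_eq0.
Qed.

(** By compactness of the support, the balls of a fixed radius centred there
    have measure bounded below: the infimum is a positive real number. *)
Lemma inf_eball_gt0 (r : R) : compact (supp P) -> 0 < r ->
  exists2 m : R, 0 < m & ereal_inf [set P (eball y r) | y in supp P] = m%:E.
Proof.
move=> cS r0; set I := ereal_inf _.
have mS := compact_measurable_rV cS.
pose s := r / d.+1%:R; have s0 : 0 < s by rewrite divr_gt0.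
have s20 : 0 < s / 2 by rewrite divr_gt0.
have [D DS SD] : finite_subset_cover (supp P) (fun y : Rd => ball y (s / 2)) (supp P).
  move: cS; rewrite compact_cover; apply.
  - by move=> y _; exact: ball_open.
  - by move=> y Sy; exists y => //; exact: ballxx.
have [y0 Sy0] := supp_neq0 mS.
have Pb x : measurable (ball x (s / 2) : set Rd).
  by apply: open_measurable_rV; exact: ball_open.
pose m := \big[Num.min/1]_(y <- finmap.enum_fset D) fine (P (ball y (s / 2))).
have m0 : 0 < m.
  rewrite /m big_seq; elim/big_ind : _ => //; first by move=> a b a0 b0; rewrite lt_min a0.
  move=> y yD; apply: fine_gt0; rewrite supp_ball_gt0//=; last by have := DS _ yD; rewrite inE.
  by rewrite -ge0_fin_numE// fin_num_measure.
have mI : (m%:E <= I)%E.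
  apply: le_ereal_inf_tmp => _ [y Sy <-]; have [z zD zy] := SD _ Sy.
  apply: (@le_trans _ _ (P (ball z (s / 2)))).
    rewrite -[leRHS]fineK ?fin_num_measure// lee_fin.
    exact: (@bigmin_inf_seq _ _ _ _ _ z).
  apply: le_measure; rewrite ?inE//; first exact: measurable_eball.
  move=> w zw; apply: ball_sub_eball => //; rewrite -/s (splitr s).
  by apply: ball_triangle zw; exact: ball_sym.
have I1 : (I <= 1)%E.
  apply: (@le_trans _ _ (P (eball y0 r))); last first.
    by apply: probability_le1; exact: measurable_eball.
  by apply: ereal_inf_lbound; exists y0.
move: mI I1; case: I => [i|//|//]; rewrite !lee_fin => mi _.
by exists i => //; rewrite (lt_le_trans m0).
Qed.

End support.

Section convexity.
Context (R : realType) (d : nat) (A : set 'rV[R]_d).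
Hypothesis cA : convex_set A.

Lemma convex_setP x y t : A x -> A y -> 0 <= t <= 1 -> A ((1 - t) *: x + t *: y).
Proof.
move=> Ax Ay /andP[t0 t1].
have t01 : 0 <= 1 - t <= 1 by apply/andP; split; lra.
have := cA (Itv01 (proj1 (andP t01)) (proj2 (andP t01))) (mem_set Ax) (mem_set Ay).
rewrite inE /conv /= /convex_lmodType /=; congr A.
by congr (_ + _ *: _); exact: subKr.
Qed.

End convexity.

(** * Affine images of the Lebesgue measure *)

Section integral_monotone_measure.
Context (R : realType) d (T : measurableType d).
Local Open Scope ereal_scope.
Import HBNNSimple.

Lemma ge0_le_integral_measure (m1 m2 : {measure set T -> \bar R}) (f : T -> \bar R) :
  (forall A, measurable A -> m1 A <= m2 A) -> (forall x, 0 <= f x) ->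
  \int[m1]_x f x <= \int[m2]_x f x.
Proof.
move=> m12 f0; rewrite !ge0_integralTE//; apply: ge_ereal_sup => _ [h hf <-].
apply: (@le_trans _ _ (sintegral m2 h)); last by apply: ereal_sup_ubound; exists h.
rewrite !sintegralE; apply: lee_fsum => // r [t _ <-].
by apply: lee_pmul => //; [rewrite lee_fin|exact: m12].
Qed.

End integral_monotone_measure.

Section affine.
Context (R : realType).
Local Open Scope ereal_scope.

(** The affine maps z |-> t * z + v of the line and of R^n. *)
Definition affR (t v : R) (z : measurableTypeR R) : measurableTypeR R := (t * z + v)%R.

Lemma measurable_affR t v : measurable_fun setT (affR t v).
Proof.
by apply: measurable_funD => //; exact: measurable_funM.
Qed.

HB.instance Definition _ t v :=
  isMeasurableFun.Build _ _ _ _ (affR t v) (measurable_affR t v).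

Lemma lebesgue_measure_affR (t v : R) (A : set (measurableTypeR R)) :
  (0 < t)%R -> measurable A ->
  lebesgue_measure (affR t v @^-1` A) = (t^-1)%:E * lebesgue_measure A.
Proof.
move=> t0 mA; have t0' := ltW t0.
rewrite (@lebesgue_measure_unique R (mscale (NngNum t0')
  (pushforward (@lebesgue_measure R) (affR t v))) _ A mA)//.
  by rewrite /mscale/= /pushforward muleA -EFinM mulVf ?gt_eqF// mul1e.
move=> _ [[a b] _ <-].
transitivity (t%:E * lebesgue_measure (affR t v @^-1` `]a, b]%classic)); last by [].
rewrite (_ : affR t v @^-1` _ = `]((a - v) / t)%R, ((b - v) / t)%R]%classic); last first.
  apply/seteqP; split => z /=; rewrite !in_itv/= ltr_pdivrMr// ler_pdivlMr//;
    by rewrite /affR ltrBlDr lerBrDr (mulrC z).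
rewrite !lebesgue_measure_itv/= !lte_fin ltr_pM2r ?invr_gt0// ltrD2r.
case: ifPn => // _; last by rewrite mule0.
rewrite -!EFinB -EFinM; congr EFin.
by field; rewrite gt_eqF.
Qed.

Definition aff n (t : R) (v : 'rV[R]_n) (x : 'rV[R]_n) : 'rV[R]_n := (t *: x + v)%R.

Lemma measurable_aff n t (v : 'rV[R]_n) : measurable_fun setT (aff t v).
Proof.
by apply: measurable_funD_rV; [exact: measurable_funZ_rV|exact: measurable_cst].
Qed.

HB.instance Definition _ n t (v : 'rV[R]_n) :=
  isMeasurableFun.Build _ _ _ _ (aff t v) (measurable_aff t v).

Lemma aff_cons_rV n (t : R) (v : 'rV[R]_n.+1) (s : R) (y : 'rV[R]_n) :
  aff t v (@cons_rV R n (s, y)) =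
  @cons_rV R n (affR t (v ord0 ord0) s, aff t (\row_j v ord0 (lift ord0 j)) y).
Proof.
apply/rowP => i; rewrite /aff /cons_rV !mxE; case: splitP => j ij; rewrite !mxE/=.
  by rewrite (_ : i = ord0)//; apply: val_inj; rewrite /= ij ord1.
by rewrite (_ : i = lift ord0 j)//; exact: val_inj.
Qed.

(** Scaling of the Lebesgue measure, by induction on the dimension: the inner
    integral scales by the one-dimensional case, the outer one by induction. *)
Lemma lebesgue_rV_aff n (t : R) (v : 'rV[R]_n) (A : set 'rV[R]_n) :
  (0 < t)%R -> measurable A ->
  lebesgue_rV R n (aff t v @^-1` A) = ((t^-1) ^+ n)%:E * lebesgue_rV R n A.
Proof.
move=> t0; elim: n v A => [|n IHn] v A mA.
  rewrite expr0 mul1e /=; congr (dirac _ _); apply/funext => x /=.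
  by congr A; apply/rowP; case.
have tn0 : (0 <= t^-1 ^+ n)%R by rewrite exprn_ge0// invr_ge0 ltW.
rewrite /= /lebesgue_cons /pushforward /product_measure2 /=.
pose v' : 'rV[R]_n := \row_j v ord0 (lift ord0 j).
pose B : set (measurableTypeR R * 'rV[R]_n) := @cons_rV R n @^-1` A.
have mB : measurable B.
  by rewrite -[B]setTI; exact: measurable_cons_rV.
pose phi (y : 'rV[R]_n) := lebesgue_measure (ysection B y).
have mphi : measurable_fun setT phi by exact: measurable_fun_ysection.
have phi0 y : 0 <= phi y by exact: measure_ge0.
transitivity (\int[lebesgue_rV R n]_y ((t^-1)%:E * phi (aff t v' y))).
  apply: eq_integral => y _; rewrite -(lebesgue_measure_affR (v ord0 ord0))//; last first.
    exact: measurable_ysection.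
  congr (lebesgue_measure _); apply/seteqP; split => s /ysectionP Bs;
    by apply/ysectionP; move: Bs; rewrite /B /= aff_cons_rV.
have mphi' := measurableT_comp mphi (measurable_aff t v').
rewrite ge0_integralZl//=; last by rewrite lee_fin invr_ge0 ltW.
rewrite exprS EFinM -muleA; congr (_ * _).
transitivity (\int[pushforward (lebesgue_rV R n) (aff t v')]_y phi y).
  by rewrite (ge0_integral_pushforward (measurable_aff t v')).
rewrite (@eq_measure_integral _ _ _ _ (mscale (NngNum tn0) (lebesgue_rV R n))).
  by rewrite ge0_integral_mscale.
by move=> C mC _; exact: IHn.
Qed.

End affine.

(** * Measures with a bounded density on a convex set *)

Section density.
Context (R : realType) (d : nat).
Local Notation Rd := ('rV[R]_d).
Variables (P : probability Rd R) (rho : Rd -> R).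
Hypothesis hrho : is_density P rho.
Variables (lambdaP LambdaP : R).
Hypothesis lambda0 : 0 < lambdaP.
Hypothesis rho_bounds : forall x, supp P x -> lambdaP <= rho x <= LambdaP.
Local Open Scope ereal_scope.

Lemma density_ub (A : set Rd) : measurable A -> A `<=` supp P ->
  P A <= LambdaP%:E * lebesgue_rV R d A.
Proof.
move=> mA AS; have [mr r0 ->//] := hrho.
rewrite -integral_cst//; apply: ge0_le_integral => //.
- by move=> x _; rewrite lee_fin.
- by apply/measurable_EFinP; exact: measurable_funTS.
- by move=> x /AS /rho_bounds /andP[_]; rewrite lee_fin.
Qed.

Lemma density_lb (A : set Rd) : measurable A -> A `<=` supp P ->
  lambdaP%:E * lebesgue_rV R d A <= P A.
Proof.
move=> mA AS; have [mr r0 ->//] := hrho.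
rewrite -integral_cst//; apply: ge0_le_integral => //.
- by move=> x _; rewrite lee_fin ltW.
- by apply/measurable_EFinP; exact: measurable_funTS.
- by move=> x /AS /rho_bounds /andP[]; rewrite lee_fin.
Qed.

Lemma density_set1 (x : Rd) : (0 < d)%N -> P [set x] = 0.
Proof.
move=> d0; have [mr r0 PE] := hrho.
have xE : [set x] = [set y : Rd | forall i, [set x ord0 i] (y ord0 i)].
  by apply/seteqP; split=> [y -> //|y /= xy]; apply/rowP => i; rewrite xy.
have mx : measurable [set x].
  by apply: compact_measurable_rV; exact: compact_set1.
rewrite PE// null_set_integral//.
  by apply/measurable_EFinP; exact: measurable_funTS.
rewrite xE; pose A (i : 'I_d) : set (measurableTypeR R) := [set x ord0 i].
have mA i : measurable (A i) by exact: measurable_set1.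
rewrite (lebesgue_rV_box mA) (bigD1 (Ordinal d0))//=.
by rewrite lebesgue_measure_set1 mul0e.
Qed.

Hypothesis cS : compact (supp P).
Let mS : measurable (supp P). Proof. exact: compact_measurable_rV. Qed.

(** A measure with a density in positive dimension has no atom, so its support
    is not reduced to a point. *)
Lemma ediam_supp_gt0 : (0 < d)%N -> (0 < ediam (supp P))%R.
Proof.
move=> d0; rewrite ltNge; apply/negP => diam0.
have [x Sx] := supp_neq0 mS.
have := probability_supp mS.
rewrite (_ : supp P = [set x]) ?density_set1// => [/eqP|].
  by rewrite eqe eq_sym oner_eq0.
apply/seteqP; split=> [y Sy|y -> //] /=; apply/rowP => i.
apply/eqP; rewrite -subr_eq0 -normr_le0 (le_trans _ diam0)//.
apply: le_trans (enorm_le_ediam cS Sy Sx).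
by have := coord_le_enorm (y - x)%R i; rewrite !mxE.
Qed.

Hypothesis cvS : convex_set (supp P).

Lemma bmeas_contraction (F : Rd -> R) (x0 : Rd) (t : R) :
  supp P x0 -> (0 <= t)%R -> (t <= 1)%R -> bmeas (supp P) F ->
  bmeas (supp P) (fun x => F ((1 - t) *: x0 + t *: x)%R).
Proof.
move=> Sx0 t0 t1 [mF [M FM]]; set T := aff t ((1 - t) *: x0)%R.
have ST x : supp P x -> supp P (T x).
  by move=> Sx; rewrite /T /aff addrC; apply: convex_setP => //; rewrite t0.
split; last by exists M => x Sx; apply: FM; have := ST x Sx; rewrite /T /aff addrC.
apply: (@eq_measurable_fun _ _ _ _ _ ((F \_ (supp P)) \o T)).
  move=> x; rewrite inE => Sx; rewrite /= patchE mem_set//; last exact: ST.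
  by rewrite /T /aff addrC.
apply: measurable_funTS; apply: measurableT_comp; last exact: measurable_aff.
exact/(measurable_restrictT _ mS).
Qed.

(** The image of P under a contraction of ratio t towards a point of its
    support is dominated by a multiple of P: by convexity the contraction maps
    the support into itself, the density is bounded above and below there, and
    the Lebesgue measure scales by the factor t^d. *)
Lemma Rintegral_contraction (F : Rd -> R) (x0 : Rd) (t : R) :
  supp P x0 -> (0 < t <= 1)%R -> bmeas (supp P) F ->
  (forall x, supp P x -> 0 <= F x)%R ->
  (\int[P]_(x in supp P) F ((1 - t) *: x0 + t *: x) <=
   LambdaP / lambdaP * t^-1 ^+ d * \int[P]_(x in supp P) F x)%R.
Proof.
move=> Sx0 /andP[t0 t1] bF F0; set T := aff t ((1 - t) *: x0).
have ST : forall x, supp P x -> supp P (T x).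
  move=> x Sx; rewrite /T /aff addrC; apply: convex_setP => //.
  by rewrite (ltW t0).
have mT : measurable_fun setT T by exact: measurable_aff.
have Lam0 : (0 <= LambdaP)%R.
  by have /andP[+ +] := rho_bounds Sx0; move: lambda0; lra.
have c0 : (0 <= LambdaP / lambdaP * t^-1 ^+ d)%R.
  by rewrite mulr_ge0 ?divr_ge0 ?exprn_ge0 ?invr_ge0 ?(ltW t0) ?(ltW lambda0).
have mTA A : measurable A -> measurable (T @^-1` A).
  by move=> mA; rewrite -[X in measurable X]setTI; exact: mT.
have dom A : measurable A ->
    pushforward P T A <= mscale (NngNum c0) P A.
  move=> mA; rewrite /pushforward /mscale /=.
  have PI B : measurable B -> P B = P (B `&` supp P).
    by move=> mB; rewrite probability_setI1//; exact: probability_supp.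
  rewrite PI; last exact: mTA.
  have mTAS : measurable (T @^-1` A `&` supp P) by apply: measurableI => //; exact: mTA.
  have mAS : measurable (A `&` supp P) by exact: measurableI.
  apply: (le_trans (density_ub mTAS _)) => //.
  apply: (@le_trans _ _ (LambdaP%:E * lebesgue_rV R d (T @^-1` (A `&` supp P)))).
    apply: lee_pmul => //; apply: le_measure; rewrite ?inE//; first exact: mTA.
    by move=> x [Ax Sx]; split => //; exact: ST.
  rewrite lebesgue_rV_aff//.
  apply: (@le_trans _ _ (LambdaP%:E * ((t^-1 ^+ d)%:E * ((lambdaP^-1)%:E * P (A `&` supp P))))).
    apply: lee_pmul => //; first by rewrite mule_ge0// lee_fin exprn_ge0// invr_ge0 ltW.
    apply: lee_pmul => //; first by rewrite lee_fin exprn_ge0// invr_ge0 ltW.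
    have := density_lb mAS (@subIsetr _ _ _).
    by rewrite -[in X in X -> _](@lee_pmul2l _ (lambdaP^-1)%:E)// ?lte_fin ?invr_gt0// muleA -EFinM mulVf ?gt_eqF// mul1e.
  rewrite !muleA -!EFinM mulrAC; apply: lee_pmul => //.
  apply: le_measure; rewrite ?inE//.
pose F' := F \_ (supp P).
have F'0 x : (0 <= F' x)%R by rewrite /F' patchE; case: ifPn => //; rewrite inE; exact: F0.
have mF' : measurable_fun setT (EFin \o F').
  by apply/measurable_EFinP/(measurable_restrictT _ mS); case: bF.
have bFT := bmeas_contraction Sx0 (ltW t0) t1 bF.
rewrite -lee_fin EFinM -!EFin_RintegralE//.
have -> : \int[P]_(x in supp P) (F x)%:E = \int[P]_x (F' x)%:E.
  rewrite integral_mkcond; apply: eq_integral => x _.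
  by rewrite /F' /patch; case: ifP.
apply: (@le_trans _ _ (\int[P]_x (F' (T x))%:E)).
  rewrite integral_mkcond; apply: ge0_le_integral => //.
  - by move=> x _; rewrite patchE; case: ifPn => // /set_mem Sx; rewrite lee_fin F0// addrC; exact: ST.
  - apply/(measurable_restrictT _ mS)/measurable_EFinP; exact: (proj1 bFT).
  - exact: (measurableT_comp mF' mT).
  - move=> x _; rewrite patchE; case: ifPn => [/set_mem Sx|_]; last by rewrite lee_fin.
    by rewrite /F' patchE mem_set ?lee_fin /T /aff ?[(t *: _ + _)%R]addrC//; have := ST _ Sx; rewrite /T /aff addrC.
rewrite -(ge0_integral_mscale _ _ (NngNum c0))//; last by move=> x _; rewrite lee_fin.
rewrite [leLHS](_ : _ = \int[pushforward P T]_x (F' x)%:E).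
  by apply: ge0_le_integral_measure => // x; rewrite lee_fin.
by rewrite (ge0_integral_pushforward mT)// => x _; rewrite lee_fin.
Qed.

End density.

(** * A Poincare inequality for sums of functions of one variable *)

(** Cauchy-Schwarz for a finite sum. *)
Lemma sqr_sum_le (R : realFieldType) n (u : nat -> R) :
  (\sum_(i < n) u i) ^+ 2 <= n%:R * \sum_(i < n) u i ^+ 2.
Proof.
elim: n => [|n IHn]; first by rewrite !big_ord0 expr0n mulr0.
rewrite !big_ord_recr /=; move: IHn.
set S := \sum_(i < n) _; set Q := \sum_(i < n) _; set w := u n => IHn.
have Q0 : 0 <= Q by apply: sumr_ge0 => i _; exact: sqr_ge0.
rewrite -natr1; have := ler0n R n; set m : R := n%:R; rewrite -/m in IHn *.
rewrite le_eqVlt => /predU1P[m0|m0].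
  have S0 : S ^+ 2 <= 0 by move: IHn; rewrite -m0 mul0r.
  have /eqP : S == 0 by rewrite -sqrf_eq0 eq_le S0 sqr_ge0.
  by move=> ->; rewrite -m0; nra.
suff : 2 * S * w <= Q + m * w ^+ 2 by nra.
rewrite -(ler_pM2l m0).
by have := sqr_ge0 (S - m * w); nra.
Qed.

(** Throughout, h(x, y) = a(x) + b(y), and Phi dominates h^2 on the products of
    balls around suitable pairs of points; every point of either support belongs
    to such a pair. *)
Section poincare.
Context (R : realType) (d : nat).
Local Notation Rd := ('rV[R]_d).
Variables (P Q : probability Rd R).
Local Notation Om := (supp P).
Local Notation Om' := (supp Q).
Hypotheses (cP : compact Om) (cQ : compact Om') (cvP : convex_set Om).
Variables (rho : Rd -> R) (lambdaP LambdaP : R).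
Hypotheses (hrho : is_density P rho) (lambda0 : 0 < lambdaP)
  (rho_bounds : forall x, Om x -> lambdaP <= rho x <= LambdaP).
Variables (r mP mQ : R) (N : nat).
Hypotheses (r0 : 0 < r) (mQ0 : 0 < mQ) (mQ1 : mQ <= 1) (mP0 : 0 < mP).
Hypothesis N0 : (0 < N)%N.
Hypothesis mQP : forall y, Om' y -> (mQ%:E <= Q (eball y r))%E.
Hypothesis mPP : forall x, Om x -> (mP%:E <= P (eball x r))%E.
Hypothesis diamN : forall x x', Om x -> Om x' -> enorm (x - x') <= N%:R * r.

Variables (a b : Rd -> R) (Phi : Rd * Rd -> R).
Hypotheses (ba : bmeas Om a) (bb : bmeas Om' b) (bPhi : bmeas (Om `*` Om') Phi).
Hypothesis Phi0 : forall z, (Om `*` Om') z -> 0 <= Phi z.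
Hypothesis nearl : forall x, Om x -> exists2 y, Om' y &
  forall x' y', Om x' -> Om' y' -> enorm (x' - x) <= r -> eball y r y' ->
  (a x' + b y') ^+ 2 <= Phi (x', y').
Hypothesis nearr : forall y, Om' y -> exists2 x, Om x &
  forall x', Om x' -> eball x r x' -> (a x' + b y) ^+ 2 <= Phi (x', y).

Let mOm : measurable Om. Proof. exact: compact_measurable_rV. Qed.
Let mOm' : measurable Om'. Proof. exact: compact_measurable_rV. Qed.
Let PE : P Om = 1%E. Proof. exact: probability_supp. Qed.
Let QE : Q Om' = 1%E. Proof. exact: probability_supp. Qed.

Let F x := \int[Q]_(y in Om') Phi (x, y).
Let G y := \int[P]_(x in Om) Phi (x, y).
Let E := \int[(P \x Q)%E]_(z in Om `*` Om') Phi z.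
Let v x := \int[P]_(x' in Om) (a x - a x') ^+ 2.

Let bF : bmeas Om F. Proof. exact: (bRintegral_prodl P Q mOm mOm' bPhi).1. Qed.
Let EF : E = \int[P]_(x in Om) F x. Proof. exact: (bRintegral_prodl P Q mOm mOm' bPhi).2. Qed.
Let bG : bmeas Om' G. Proof. exact: (bRintegral_prodr P Q mOm mOm' bPhi).1. Qed.
Let EG : E = \int[Q]_(y in Om') G y. Proof. exact: (bRintegral_prodr P Q mOm mOm' bPhi).2. Qed.
Let F0 x : Om x -> 0 <= F x.
Proof. by move=> Ox; apply: Rintegral_ge0 => y Oy; exact: Phi0. Qed.

Let bv : bmeas Om v.
Proof.
apply: (bRintegral_prodl P P mOm mOm (f := fun z => (a z.1 - a z.2) ^+ 2) _).1 => //.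
by apply: bmeasX; apply: bmeasB; [exact: bmeas_fst|exact: bmeas_snd].
Qed.

(* h(x, .) - h(x', .) is the constant a(x) - a(x'), which is thus controlled by
   the average of Phi over a ball in the second variable. *)
Let local_step x x' : Om x -> Om x' -> enorm (x' - x) <= r ->
  mQ * (a x - a x') ^+ 2 <= 2 * F x + 2 * F x'.
Proof.
move=> Ox Ox' xx'; have [y Oy yP] := nearl Ox.
have bx := bmeas_sectionl mOm mOm' Ox bPhi; have bx' := bmeas_sectionl mOm mOm' Ox' bPhi.
rewrite -!bRintegralZ// -bRintegralD//; [|exact: bmeasZ|exact: bmeasZ].
apply: (le_trans (_ : _ <= (a x - a x') ^+ 2 * fine (Q (Om' `&` eball y r)))).
  rewrite mulrC ler_wpM2l ?sqr_ge0// setIC probability_setI1//; last exact: measurable_eball.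
  by rewrite -lee_fin fineK ?fin_num_measure// ?mQP//; exact: measurable_eball.
apply: markov_Rintegral => //.
- by apply: bmeasD; exact: bmeasZ.
- by move=> y' Oy'; rewrite addr_ge0// mulr_ge0// Phi0.
- exact: measurable_eball.
- move=> y' Oy' yy'.
  have := yP x y' Ox Oy'; rewrite subrr enorm0 => /(_ (ltW r0) yy').
  have := yP x' y' Ox' Oy' xx' yy'.
  have := sqr_ge0 (a x + b y' + (a x' + b y')).
  nra.
Qed.

Let K := LambdaP / lambdaP * N%:R ^+ d * E.

Let Lam1 : 1 <= LambdaP / lambdaP.
Proof.
have [x Ox] := supp_neq0 mOm.
by rewrite ler_pdivlMr// mul1r; have /andP[] := rho_bounds Ox; exact: le_trans.
Qed.

Let E0 : 0 <= E. Proof. by apply: Rintegral_ge0 => z; exact: Phi0. Qed.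

Let EK : E <= K.
Proof.
rewrite /K ler_peMl// -[leLHS]mulr1 ler_pM// exprn_ege1// ler1n//.
Qed.

Let Nr0 : 0 < N%:R :> R. Proof. by rewrite ltr0n. Qed.

(* The subdivision of the segment from x to x' into N pieces. *)
Let pt (x x' : Rd) (i : nat) : Rd := (1 - i%:R / N%:R) *: x + (i%:R / N%:R) *: x'.

Let iN i : (i <= N)%N -> 0 <= (i%:R / N%:R : R) <= 1.
Proof. by move=> ?; rewrite divr_ge0//= ler_pdivrMr// mul1r ler_nat. Qed.

Let J0 x : Om x -> \int[P]_(x' in Om) F (pt x x' 0) = F x.
Proof.
move=> Ox; rewrite -[RHS](Rintegral_cst1 mOm PE); apply: eq_Rintegral => x' _.
by rewrite /pt mul0r subr0 scale1r scale0r addr0.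
Qed.

(* The point of index i + 1 depends on x' through a contraction of ratio
   (i + 1) / N towards x, whose distortion is at most N^d. *)
Let JS x i : Om x -> (i < N)%N -> \int[P]_(x' in Om) F (pt x x' i.+1) <= K.
Proof.
move=> Ox iN'; have i0 : 0 < i.+1%:R :> R by rewrite ltr0n.
have tN : 0 < (i.+1%:R / N%:R : R) <= 1.
  by rewrite divr_gt0//=; have /andP[] := iN iN'.
apply: (le_trans (Rintegral_contraction hrho lambda0 rho_bounds cP cvP Ox tN bF F0)).
rewrite /K -EF ler_wpM2r// ler_wpM2l// ?(le_trans ler01)//.
rewrite invf_div lerXn2r// ?nnegrE ?divr_ge0//.
by rewrite ler_pdivrMr// ler_peMr// ler1n.
Qed.

Let bpt x i : Om x -> (i <= N)%N -> bmeas Om (fun x' => F (pt x x' i)).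
Proof.
move=> Ox /iN/andP[i0 i1].
exact: (bmeas_contraction cP cvP Ox i0 i1 bF).
Qed.

(* Consecutive points of the subdivision are within r of each other. *)
Let chain x x' : Om x -> Om x' ->
  mQ * (a x - a x') ^+ 2 <=
  N%:R * \sum_(i < N) (2 * F (pt x x' i) + 2 * F (pt x x' i.+1)).
Proof.
move=> Ox Ox'.
have Opt i : (i <= N)%N -> Om (pt x x' i) by move=> /iN; exact: convex_setP.
have -> : a x - a x' = \sum_(i < N) (a (pt x x' i) - a (pt x x' i.+1)).
  rewrite -(big_mkord xpredT (fun i => a (pt x x' i) - a (pt x x' i.+1))).
  rewrite (eq_bigr (fun i => - (a (pt x x' i.+1) - a (pt x x' i)))); last first.
    by move=> i _; rewrite opprB.
  rewrite sumrN telescope_sumr// opprB.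
  by rewrite /pt mul0r subr0 divff ?gt_eqF// subrr !scale1r !scale0r addr0 add0r.
apply: (le_trans (ler_wpM2l (ltW mQ0) (sqr_sum_le N (fun i => a (pt x x' i) - a (pt x x' i.+1))))).
rewrite mulrCA ler_wpM2l// mulr_sumr; apply: ler_sum => i _.
apply: local_step; [exact/Opt/ltnW|exact: Opt|].
have -> : pt x x' i.+1 - pt x x' i = N%:R^-1 *: (x' - x).
  apply/rowP => j; rewrite !mxE -natr1; field; exact: lt0r_neq0.
rewrite enormZ ger0_norm ?invr_ge0// ler_pdivrMl//; exact: diamN.
Qed.

Let v_le x : Om x -> mQ * v x <= N%:R * (2 * F x + (4 * N%:R - 2) * K).
Proof.
move=> Ox.
have bpt' i : (i < N)%N -> bmeas Om (fun x' => 2 * F (pt x x' i) + 2 * F (pt x x' i.+1)).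
  by move=> iltN; apply: bmeasD; apply: bmeasZ; apply: bpt => //; exact: ltnW.
have bS := bmeas_sum bpt'.
have bsq : bmeas Om (fun x' => (a x - a x') ^+ 2).
  by apply: bmeasX; apply: bmeasB => //; exact: bmeas_cst.
rewrite -bRintegralZ//.
apply: (le_trans (ler_bRintegral P mOm (bmeasZ _ bsq) (bmeasZ _ bS) (fun x' => chain Ox))).
rewrite bRintegralZ// ler_wpM2l// (bRintegral_sum P mOm bpt').
have [J JP] : exists J : nat -> R, forall i, \int[P]_(x' in Om) F (pt x x' i) = J i.
  by exists (fun i => \int[P]_(x' in Om) F (pt x x' i)).
have JE i : (i < N)%N ->
    \int[P]_(x' in Om) (2 * F (pt x x' i) + 2 * F (pt x x' i.+1)) = 2 * J i + 2 * J i.+1.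
  move=> iltn; have b1 := bpt Ox (ltnW iltn); have b2 := bpt Ox iltn.
  rewrite (bRintegralD P mOm (bmeasZ 2 b1) (bmeasZ 2 b2)).
  by rewrite (bRintegralZ P mOm 2 b1) (bRintegralZ P mOm 2 b2) !JP.
have J0x : J 0%N = F x by rewrite -JP J0.
have JSx i : (i < N)%N -> J i.+1 <= K by move=> iltn; rewrite -JP; exact: JS.
apply: (@le_trans _ _ (\sum_(i < N) (2 * J i + 2 * J i.+1))).
  by apply: ler_sum => i _; rewrite JE.
rewrite big_split /= -!mulr_sumr.
have S2 : \sum_(i < N) J i.+1 <= N%:R * K.
  apply: (le_trans (ler_sum _ (fun (i : 'I_N) _ => JSx i (ltn_ord i)))).
  by rewrite sumr_const card_ord mulr_natl.
have S1 : \sum_(i < N) J i <= F x + (N%:R - 1) * K.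
  clear -N0 J0x JSx; case: N N0 JSx => // n _ JSx.
  rewrite big_ord_recl J0x lerD2l -natr1 addrK.
  apply: (le_trans (ler_sum _ (fun (i : 'I_n) _ => JSx i (ltnW (ltn_ord i))))).
  by rewrite sumr_const card_ord mulr_natl.
by move: S1 S2; lra.
Qed.

(** A Poincare inequality for functions of the form a(x) + b(y). Chaining along
    segments bounds the variance of a by the integral of Phi; the inequality
    h(x, y)^2 <= 3 h(x', y)^2 + (3/2) (a(x) - a(x'))^2, averaged over x' in a
    ball, then bounds h. The weights 3 and 3/2 give the constant 9 = 3 + 6. *)
Lemma poincare : mP * \int[(P \x Q)%E]_(z in Om `*` Om') (a z.1 + b z.2) ^+ 2 <=
  9 * (N%:R ^+ (d + 2) * (LambdaP / lambdaP) / mQ) * E.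
Proof.
have V_le : mQ * \int[P]_(x in Om) v x <= 4 * N%:R ^+ 2 * K.
  have b1 : bmeas Om (fun x => N%:R * (2 * F x + (4 * N%:R - 2) * K)).
    by apply: bmeasZ; apply: bmeasD; [exact: bmeasZ|exact: bmeas_cst].
  rewrite -bRintegralZ//; apply: (le_trans (ler_bRintegral P mOm (bmeasZ _ bv) b1 v_le)).
  have b2 := bmeasZ 2 bF; have b3 := bmeas_cst Om ((4 * N%:R - 2) * K).
  rewrite (bRintegralZ P mOm _ (bmeasD b2 b3)) (bRintegralD P mOm b2 b3).
  rewrite (bRintegralZ P mOm 2 bF) (Rintegral_cst1 mOm PE).
  rewrite -EF (_ : 4 * N%:R ^+ 2 * K = N%:R * (4 * N%:R * K)); last by ring.
  rewrite ler_wpM2l//.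
  by move: EK; lra.
have bh : bmeas (Om `*` Om') (fun z => (a z.1 + b z.2) ^+ 2).
  by apply: bmeasX; apply: bmeasD; [exact: bmeas_fst|exact: bmeas_snd].
have bGv : bmeas (Om `*` Om') (fun z => 3 * G z.2 + 3 / 2 * v z.1).
  by apply: bmeasD; apply: bmeasZ; [exact: bmeas_snd|exact: bmeas_fst].
have hGv z : (Om `*` Om') z -> mP * (a z.1 + b z.2) ^+ 2 <= 3 * G z.2 + 3 / 2 * v z.1.
  case: z => x y [/= Ox Oy]; have [x0 Ox0 xP] := nearr Oy.
  have by_ := bmeas_sectionr mOm mOm' Oy bPhi.
  have bsq : bmeas Om (fun x' => (a x - a x') ^+ 2).
    by apply: bmeasX; apply: bmeasB => //; exact: bmeas_cst.
  rewrite -!bRintegralZ// -bRintegralD//; [|exact: bmeasZ|exact: bmeasZ].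
  apply: (le_trans (_ : _ <= (a x + b y) ^+ 2 * fine (P (Om `&` eball x0 r)))).
    rewrite mulrC ler_wpM2l ?sqr_ge0// setIC probability_setI1//; last exact: measurable_eball.
    by rewrite -lee_fin fineK ?fin_num_measure// ?mPP//; exact: measurable_eball.
  apply: markov_Rintegral => //.
  - by apply: bmeasD; exact: bmeasZ.
  - by move=> x' Ox'; rewrite addr_ge0// mulr_ge0// ?sqr_ge0// Phi0.
  - exact: measurable_eball.
  - move=> x' Ox' xx'; have := xP x' Ox' xx'.
    by have := sqr_ge0 (2 * (a x' + b y) - (a x - a x')); nra.
have mD : measurable (Om `*` Om') by exact: measurableX.
rewrite -bRintegralZ//; apply: (le_trans (ler_bRintegral _ mD (bmeasZ _ bh) bGv hGv)).
rewrite bRintegralD//; [|by apply: bmeasZ; exact: bmeas_snd|by apply: bmeasZ; exact: bmeas_fst].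
rewrite !bRintegralZ//; [|exact: bmeas_fst|exact: bmeas_snd].
rewrite bRintegral_snd// bRintegral_fst// -EG.
have {}V_le : \int[P]_(x in Om) v x <= 4 * (N%:R ^+ 2 * K / mQ).
  by rewrite mulrA ler_pdivlMr// mulrC mulrA.
have -> : 9 * (N%:R ^+ (d + 2) * (LambdaP / lambdaP) / mQ) * E = 9 * (N%:R ^+ 2 * K / mQ).
  by rewrite /K exprD; ring.
suff : E <= N%:R ^+ 2 * K / mQ by lra.
rewrite ler_pdivlMr//; apply: (@le_trans _ _ E); first by rewrite ler_piMr.
by rewrite (le_trans EK)// ler_peMl ?(le_trans E0)// exprn_ege1// ler1n.
Qed.

End poincare.

(** * Calculus of the dual objective *)

(** The square of the positive part is convex, and its derivative is 2-Lipschitz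
    ([max0_sqr_ub]). *)
Lemma max0_sqr_lb (R : realFieldType) (u v : R) :
  Num.max u 0 ^+ 2 + 2 * Num.max u 0 * (v - u) <= Num.max v 0 ^+ 2.
Proof.
have : 0 <= Num.max v 0 by rewrite le_max lexx orbT.
have : v <= Num.max v 0 by rewrite le_max lexx.
have [u0|u0] := leP u 0.
  by rewrite expr0n/= !mulr0 mul0r addr0 sqr_ge0.
move=> v1 v2; set w := Num.max v 0 in v1 v2 *.
by have := sqr_ge0 (w - u); nra.
Qed.

Lemma max0_sqr_ub (R : realFieldType) (u v : R) :
  Num.max v 0 ^+ 2 <= Num.max u 0 ^+ 2 + 2 * Num.max u 0 * (v - u) + (v - u) ^+ 2.
Proof.
have [u0|u0] := leP u 0; have [v0|v0] := leP v 0.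
- by rewrite expr0n/= !(mulr0, mul0r, add0r) sqr_ge0.
- rewrite expr0n/= !(mulr0, mul0r, add0r) lerXn2r ?nnegrE//; lra.
- by rewrite expr0n/=; have := sqr_ge0 v; lra.
- by lra.
Qed.

Lemma max0_lip (R : realFieldType) (u v : R) :
  `|Num.max u 0 - Num.max v 0| <= `|u - v|.
Proof.
rewrite ler_norml; have := ler_norm (u - v); have := ler_norm (- (u - v)).
rewrite normrN; set a := `|u - v|; have a0 : 0 <= a by exact: normr_ge0.
move=> h1 h2; by have [u0|u0] := leP u 0; have [v0|v0] := leP v 0; apply/andP; split; lra.
Qed.

Section dual_objective.
Context (R : realType) (d : nat).
Local Notation Rd := ('rV[R]_d).
Variables (P Q : probability Rd R) (c : Rd -> Rd -> R) (eps : R).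
Local Notation Om := (supp P).
Local Notation Om' := (supp Q).
Hypotheses (eps0 : 0 < eps) (mOm : measurable Om) (mOm' : measurable Om').
Hypothesis bc : bmeas (Om `*` Om') (fun z => c z.1 z.2).

Implicit Types f g p q : Rd -> R.

Local Notation Gam := (Gamma P Q c eps).
Local Notation D1 := (D1Gamma Q c eps).
Local Notation D2 := (D2Gamma P c eps).
Local Notation PQ := (P \x Q)%E.
Local Notation D := (Om `*` Om').

Let PE : P Om = 1%E. Proof. exact: probability_supp. Qed.
Let QE : Q Om' = 1%E. Proof. exact: probability_supp. Qed.
Let mD : measurable D. Proof. exact: measurableX. Qed.

(** The positive part of f + g - c. *)
Definition slack (f g : Rd -> R) (z : Rd * Rd) : R :=
  Num.max (oplus f g z - c z.1 z.2) 0.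

Lemma slack_ge0 f g z : 0 <= slack f g z.
Proof. by rewrite /slack le_max lexx orbT. Qed.

Lemma bmeas_oplus f g : bmeas Om f -> bmeas Om' g -> bmeas D (oplus f g).
Proof. by move=> bf bg; apply: bmeasD; [exact: bmeas_fst|exact: bmeas_snd]. Qed.

Lemma bmeas_slack f g : bmeas Om f -> bmeas Om' g -> bmeas D (slack f g).
Proof. by move=> bf bg; apply: bmeas_max0; apply: bmeasB => //; exact: bmeas_oplus. Qed.

Lemma eq_Gamma f g f' g' : (forall x, Om x -> f x = f' x) ->
  (forall y, Om' y -> g y = g' y) -> Gam f g = Gam f' g'.
Proof.
move=> ff gg; apply: eq_bRintegral => -[x y] [/= Ox Oy].
by rewrite /oplus /= ff// gg.
Qed.

Lemma bmeas_D1 f g : bmeas Om f -> bmeas Om' g -> bmeas Om (D1 f g).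
Proof.
move=> bf bg; apply: bmeasB; first exact: bmeas_cst.
by apply: bmeasZ; exact: (bRintegral_prodl P Q mOm mOm' (bmeas_slack bf bg)).1.
Qed.

Lemma bmeas_D2 f g : bmeas Om f -> bmeas Om' g -> bmeas Om' (D2 f g).
Proof.
move=> bf bg; apply: bmeasB; first exact: bmeas_cst.
by apply: bmeasZ; exact: (bRintegral_prodr P Q mOm mOm' (bmeas_slack bf bg)).1.
Qed.

(** The derivative of the dual objective at (f, g) in the direction (p, q). *)
Definition dGamma f g (p q : Rd -> R) : R :=
  \int[P]_(x in Om) (D1 f g x * p x) + \int[Q]_(y in Om') (D2 f g y * q y).

Lemma dGammaE f g p q : bmeas Om f -> bmeas Om' g -> bmeas Om p -> bmeas Om' q ->
  dGamma f g p q =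
  \int[PQ]_(z in D) ((1 - eps^-1 * slack f g z) * oplus p q z).
Proof.
move=> bf bg bp bq; have bs := bmeas_slack bf bg.
pose w z := 1 - eps^-1 * slack f g z.
have bw : bmeas D w by apply: bmeasB; [exact: bmeas_cst|exact: bmeasZ].
have bw1 : bmeas D (fun z => w z * p z.1) by apply: bmeasM => //; exact: bmeas_fst.
have bw2 : bmeas D (fun z => w z * q z.2) by apply: bmeasM => //; exact: bmeas_snd.
rewrite (@eq_bRintegral _ _ _ _ _ _ (fun z => w z * p z.1 + w z * q z.2)); last first.
  by move=> z _; rewrite /oplus mulrDr.
rewrite (bRintegralD PQ mD bw1 bw2).
have [_ ->] := bRintegral_prodl P Q mOm mOm' bw1.
have [_ ->] := bRintegral_prodr P Q mOm mOm' bw2.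
congr (_ + _).
  apply: eq_bRintegral => x Ox /=.
  have bsx := bmeas_sectionl mOm mOm' Ox bs.
  have bwx := bmeas_sectionl mOm mOm' Ox bw.
  rewrite mulrC (_ : \int[Q]_(y in Om') _ = \int[Q]_(y in Om') (p x * w (x, y))).
    rewrite (bRintegralZ Q mOm' _ bwx); congr (_ * _).
    rewrite (bRintegralB Q mOm' (bmeas_cst Om' 1) (bmeasZ eps^-1 bsx)).
    by rewrite (Rintegral_cst1 mOm' QE) (bRintegralZ Q mOm' _ bsx).
  by apply: eq_bRintegral => y _; rewrite mulrC.
apply: eq_bRintegral => y Oy /=.
have bsx := bmeas_sectionr mOm mOm' Oy bs.
have bwx := bmeas_sectionr mOm mOm' Oy bw.
rewrite mulrC (_ : \int[P]_(x in Om) _ = \int[P]_(x in Om) (q y * w (x, y))).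
  rewrite (bRintegralZ P mOm _ bwx); congr (_ * _).
  rewrite (bRintegralB P mOm (bmeas_cst Om 1) (bmeasZ eps^-1 bsx)).
  by rewrite (Rintegral_cst1 mOm PE) (bRintegralZ P mOm _ bsx).
by apply: eq_bRintegral => x _; rewrite mulrC.
Qed.

Let bGam f g : bmeas Om f -> bmeas Om' g ->
  bmeas D (fun z => oplus f g z - (2 * eps)^-1 * slack f g z ^+ 2).
Proof.
move=> bf bg; apply: bmeasB; first exact: bmeas_oplus.
by apply: bmeasZ; apply: bmeasX; exact: bmeas_slack.
Qed.

(** Concavity of the dual objective. *)
Lemma Gamma_le_linear f g p q :
  bmeas Om f -> bmeas Om' g -> bmeas Om p -> bmeas Om' q ->
  Gam (f \+ p) (g \+ q) <= Gam f g + dGamma f g p q.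
Proof.
move=> bf bg bp bq; rewrite dGammaE//.
have bd : bmeas D (fun z => (1 - eps^-1 * slack f g z) * oplus p q z).
  apply: bmeasM; last exact: bmeas_oplus.
  by apply: bmeasB; [exact: bmeas_cst|apply: bmeasZ; exact: bmeas_slack].
rewrite /Gamma -(bRintegralD PQ mD (bGam bf bg) bd).
apply: ler_bRintegral => //; [|exact: (bmeasD (bGam bf bg) bd)|].
  by apply: bGam; exact: bmeasD.
move=> z _; rewrite /slack.
have := max0_sqr_lb (oplus f g z - c z.1 z.2) (oplus (f \+ p) (g \+ q) z - c z.1 z.2).
rewrite (_ : oplus (f \+ p) (g \+ q) z = oplus f g z + oplus p q z); last first.
  by rewrite /oplus/=; ring.
set u := Num.max _ _; set v := Num.max _ _; rewrite -(ler_pM2l (_ : 0 < (2 * eps)^-1)); last first.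
  by rewrite invr_gt0 mulr_gt0.
rewrite mulrDr (_ : (2 * eps)^-1 * (2 * u * _) = eps^-1 * u * oplus p q z).
  by lra.
by field; exact: lt0r_neq0.
Qed.

(** Smoothness: the derivative is (1/eps)-Lipschitz. *)
Lemma Gamma_ge_quadratic f g p q :
  bmeas Om f -> bmeas Om' g -> bmeas Om p -> bmeas Om' q ->
  Gam f g + dGamma f g p q - (2 * eps)^-1 * \int[PQ]_(z in D) (oplus p q z ^+ 2)
  <= Gam (f \+ p) (g \+ q).
Proof.
move=> bf bg bp bq; rewrite dGammaE//.
have bd : bmeas D (fun z => (1 - eps^-1 * slack f g z) * oplus p q z).
  apply: bmeasM; last exact: bmeas_oplus.
  by apply: bmeasB; [exact: bmeas_cst|apply: bmeasZ; exact: bmeas_slack].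
have b2 : bmeas D (fun z => oplus p q z ^+ 2) by apply: bmeasX; exact: bmeas_oplus.
rewrite /Gamma -(bRintegralD PQ mD (bGam bf bg) bd) -(bRintegralZ PQ mD _ b2).
rewrite -(bRintegralB PQ mD (bmeasD (bGam bf bg) bd) (bmeasZ _ b2)).
apply: ler_bRintegral => //; [exact: (bmeasB (bmeasD (bGam bf bg) bd) (bmeasZ _ b2))| |].
  by apply: bGam; exact: bmeasD.
move=> z _; rewrite /slack.
have := max0_sqr_ub (oplus f g z - c z.1 z.2) (oplus (f \+ p) (g \+ q) z - c z.1 z.2).
rewrite (_ : oplus (f \+ p) (g \+ q) z = oplus f g z + oplus p q z); last first.
  by rewrite /oplus/=; ring.
move: (oplus p q z) => o; set u := Num.max (oplus f g z - _) _; set v := Num.max _ _.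
rewrite (_ : oplus f g z + o - c z.1 z.2 - (oplus f g z - c z.1 z.2) = o); last by ring.
rewrite -(ler_pM2l (_ : 0 < (2 * eps)^-1)); last first.
  by rewrite invr_gt0 mulr_gt0.
rewrite !mulrDr (_ : (2 * eps)^-1 * (2 * u * _) = eps^-1 * u * o).
  by lra.
by field; exact: lt0r_neq0.
Qed.

(** The squared L^2 norms of the two components of the gradient. *)
Definition sqr_D1 f g := \int[P]_(x in Om) (D1 f g x ^+ 2).
Definition sqr_D2 f g := \int[Q]_(y in Om') (D2 f g y ^+ 2).

Lemma Gamma_step1 f g eta : bmeas Om f -> bmeas Om' g ->
  Gam f g + eta * (1 - eta / (2 * eps)) * sqr_D1 f g <=
  Gam (fun x => f x + eta * D1 f g x) g.
Proof.
move=> bf bg; have bD := bmeas_D1 bf bg; have b2 := bmeasX 2 bD.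
have := Gamma_ge_quadratic bf bg (bmeasZ eta bD) (bmeas_cst Om' 0).
rewrite /dGamma (@eq_bRintegral _ _ _ P _ _ (fun x => eta * D1 f g x ^+ 2)); last first.
  by move=> x _; ring.
rewrite (bRintegralZ P mOm eta b2) (@eq_bRintegral _ _ _ Q _ _ (fun=> 0)); last first.
  by move=> y _; rewrite mulr0.
rewrite (Rintegral_cst1 mOm' QE) (@eq_bRintegral _ _ _ PQ _ _ (fun z => eta ^+ 2 * D1 f g z.1 ^+ 2)); last first.
  by move=> z _; rewrite /oplus addr0 exprMn.
rewrite (bRintegralZ PQ mD _ (bmeas_fst mOm mOm' b2)) (bRintegral_fst P mOm mOm' QE b2) -/(sqr_D1 f g).
rewrite (@eq_Gamma _ (g \+ _) (fun x => f x + eta * D1 f g x) g)//=; last first.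
  by move=> y _; rewrite addr0.
apply: le_trans; rewrite le_eqVlt; apply/orP; left; apply/eqP.
by field; exact: lt0r_neq0.
Qed.

Lemma Gamma_step2 f g eta : bmeas Om f -> bmeas Om' g ->
  Gam f g + eta * (1 - eta / (2 * eps)) * sqr_D2 f g <=
  Gam f (fun y => g y + eta * D2 f g y).
Proof.
move=> bf bg; have bD := bmeas_D2 bf bg; have b2 := bmeasX 2 bD.
have := Gamma_ge_quadratic bf bg (bmeas_cst Om 0) (bmeasZ eta bD).
rewrite /dGamma (@eq_bRintegral _ _ _ Q _ _ (fun x => eta * D2 f g x ^+ 2)); last first.
  by move=> x _; ring.
rewrite (bRintegralZ Q mOm' eta b2) (@eq_bRintegral _ _ _ P _ _ (fun=> 0)); last first.
  by move=> y _; rewrite mulr0.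
rewrite (Rintegral_cst1 mOm PE) (@eq_bRintegral _ _ _ PQ _ _ (fun z => eta ^+ 2 * D2 f g z.2 ^+ 2)); last first.
  by move=> z _; rewrite /oplus add0r exprMn.
rewrite (bRintegralZ PQ mD _ (bmeas_snd mOm mOm' b2)) (bRintegral_snd Q mOm mOm' PE b2) -/(sqr_D2 f g).
rewrite (@eq_Gamma (f \+ _) _ f (fun x => g x + eta * D2 f g x))//=; last first.
  by move=> y _; rewrite addr0.
apply: le_trans; rewrite le_eqVlt; apply/orP; left; apply/eqP.
by field; exact: lt0r_neq0.
Qed.

Lemma sqr_D2_lip f f' g : bmeas Om f -> bmeas Om f' -> bmeas Om' g ->
  \int[Q]_(y in Om') ((D2 f' g y - D2 f g y) ^+ 2) <=
  eps^-1 ^+ 2 * \int[P]_(x in Om) ((f' x - f x) ^+ 2).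
Proof.
move=> bf bf' bg; have bff : bmeas Om (fun x => (f' x - f x) ^+ 2).
  by apply: bmeasX; exact: bmeasB.
apply: Rintegral_ub => //.
  by apply: bmeasX; apply: bmeasB; exact: bmeas_D2.
move=> y Oy; have bs := bmeas_sectionr mOm mOm' Oy (bmeas_slack bf bg).
have bs' := bmeas_sectionr mOm mOm' Oy (bmeas_slack bf' bg).
rewrite (_ : D2 f' g y - D2 f g y = eps^-1 *
    \int[P]_(x in Om) (slack f g (x, y) - slack f' g (x, y))); last first.
  by rewrite (bRintegralB P mOm bs bs') /D2Gamma /slack /oplus /=; ring.
rewrite exprMn ler_wpM2l ?sqr_ge0//.
apply: (le_trans (Rintegral_sqr_le mOm PE (bmeasB bs bs'))).
apply: ler_bRintegral => //; first by apply: bmeasX; exact: (bmeasB bs bs').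
move=> x _; rewrite -(real_normK (num_real (f' x - f x))).
rewrite -[leLHS]real_normK ?num_real// lerXn2r ?nnegrE//.
apply: (le_trans (max0_lip _ _)); rewrite /oplus/= distrC.
by rewrite (_ : _ - _ - _ = f' x - f x)//; ring.
Qed.

(** The gain of one sweep of coordinate ascent. The second component of the
    gradient is evaluated at the updated f; replacing it by its value at the old
    f costs at most the gain of the first step, because 2 eta^2 <= eps^2. *)
Lemma Gamma_sweep f g f' g' eta : bmeas Om f -> bmeas Om' g ->
  0 < eta -> 2 * eta ^+ 2 <= eps ^+ 2 ->
  (forall x, Om x -> f' x = f x + eta * D1 f g x) ->
  (forall y, Om' y -> g' y = g y + eta * D2 f' g y) ->
  Gam f g + eta * (1 - eta / (2 * eps)) / 2 * (sqr_D1 f g + sqr_D2 f g) <= Gam f' g'.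
Proof.
move=> bf bg eta0 eta2 f'E g'E.
have bD1 := bmeas_D1 bf bg; have bD2 := bmeas_D2 bf bg.
have bf' : bmeas Om f'.
  by apply: eq_bmeas (bmeasD bf (bmeasZ eta bD1)) => x Ox; rewrite f'E.
have bD2' := bmeas_D2 bf' bg.
have s1 := Gamma_step1 eta bf bg; have s2 := Gamma_step2 eta bf' bg.
rewrite [leRHS](@eq_Gamma _ _ f' g) in s1; [|by move=> x /f'E|by []].
rewrite [leRHS](@eq_Gamma _ _ f' g') in s2; [|by []|by move=> y /g'E].
have lip := sqr_D2_lip bf bf' bg.
have e1 : 0 < eta * (1 - eta / (2 * eps)).
  rewrite mulr_gt0// subr_gt0 ltr_pdivrMr ?mulr_gt0// mul1r.
  rewrite ltNge; apply/negP => le.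
  have e2 : 0 < eps ^+ 2 by rewrite exprn_gt0.
  have : (2 * eps) ^+ 2 <= eta ^+ 2 by rewrite lerXn2r ?nnegrE// ltW// mulr_gt0.
  by rewrite exprMn; lra.
have : sqr_D2 f g <= 2 * sqr_D2 f' g + 2 * \int[Q]_(y in Om') ((D2 f' g y - D2 f g y) ^+ 2).
  have b1 := bmeasX 2 bD2'; have b2 := bmeasX 2 (bmeasB bD2' bD2).
  rewrite /sqr_D2 -(bRintegralZ Q mOm' 2 b1) -(bRintegralZ Q mOm' 2 b2).
  rewrite -(bRintegralD Q mOm' (bmeasZ 2 b1) (bmeasZ 2 b2)).
  apply: ler_bRintegral => //; [exact: bmeasX|exact: bmeasD (bmeasZ 2 b1) (bmeasZ 2 b2)|].
  move=> y _; set p := D2 f g y; set q := D2 f' g y.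
  by have := sqr_ge0 (2 * q - p); nra.
have : 2 * \int[Q]_(y in Om') ((D2 f' g y - D2 f g y) ^+ 2) <= sqr_D1 f g.
  apply: (@le_trans _ _ (2 * (eps^-1 ^+ 2 * (eta ^+ 2 * sqr_D1 f g)))).
    rewrite ler_wpM2l//; apply: (le_trans lip); rewrite ler_wpM2l ?sqr_ge0//.
    rewrite /sqr_D1 -(bRintegralZ P mOm _ (bmeasX 2 bD1)) le_eqVlt.
    apply/orP; left; apply/eqP; apply: eq_bRintegral => x Ox.
    by rewrite f'E// addrC addKr exprMn.
  rewrite (_ : 2 * _ = 2 * eta ^+ 2 / eps ^+ 2 * sqr_D1 f g); last first.
    by field; exact: lt0r_neq0.
  rewrite ler_piMl//; first by apply: Rintegral_ge0 => x _; exact: sqr_ge0.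
  by rewrite ler_pdivrMr ?exprn_gt0// mul1r.
move: s1 s2 e1; set A := eta * _; set d1 := sqr_D1 f g; set d2 := sqr_D2 f g.
rewrite -/(sqr_D1 f g) -/(sqr_D2 f' g) -/d1; set d2' := sqr_D2 f' g.
set e := \int[Q]_(y in Om') _ => s1 s2 A0 h1 h2.
have : A * (d1 + d2) <= A * (2 * d1 + 2 * d2') by rewrite ler_wpM2l ?(ltW A0)//; lra.
lra.
Qed.

End dual_objective.

(** * Strong duality *)

Section integral_tools.
Context (R : realType) d (T : measurableType d).
Local Open Scope ereal_scope.

Lemma sqr_Lnorm2 (mu : {measure set T -> \bar R}) (h : T -> R) :
  'N[mu]_2%:E[EFin \o h] ^+ 2 = \int[mu]_x (h x ^+ 2)%:E.
Proof.
have sqrE (x : \bar R) : 0 <= x -> x ^+ 2 = x `^ 2.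
  case: x => [r r0|_|//]; last by rewrite poweRyr// mulyy.
  by rewrite poweR_EFin powR_mulrn.
rewrite sqrE ?Lnorm_ge0// poweR_Lnorm//; apply: eq_integral => x _ /=.
by rewrite powR_mulrn// real_normK ?num_real.
Qed.

Lemma integral_full (P : probability T R) (D : set T) (f : T -> \bar R) :
  measurable D -> P D = 1 -> measurable_fun setT f ->
  \int[P]_x f x = \int[P]_(x in D) f x.
Proof.
move=> mD PD mf; rewrite [RHS]integral_mkcond; apply: ae_eq_integral => //.
  by apply/(measurable_restrictT _ mD); exact: measurable_funTS.
have PC : P (~` D) = 0 by rewrite probability_setC// PD subee.
exists (~` D); split => //; first exact: measurableC.
by move=> x /= nfx Dx; apply: nfx => _; rewrite patchE mem_set.
Qed.

(** A real-valued version p of the Radon-Nikodym derivative. *)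
Lemma sqnorm_densityP (nu mu : probability T R) : nu `<< mu ->
  exists p : T -> R, [/\ mu.-integrable setT (EFin \o p),
    sqnorm_density nu mu = \int[mu]_x (p x ^+ 2)%:E &
    forall E f, measurable E -> bmeas E f ->
      \int[mu]_(x in E) (f x * p x)%:E = \int[nu]_(x in E) (f x)%:E].
Proof.
move=> numu; set dp := Radon_Nikodym (charge_of_finite_measure nu) mu.
have dpE : dp = EFin \o (fine \o dp).
  by apply/funext => z /=; rewrite fineK// Radon_Nikodym_fin_num.
exists (fine \o dp); split.
- rewrite -dpE; exact: Radon_Nikodym_integrable.
- by rewrite /sqnorm_density asboolT// -/dp dpE sqr_Lnorm2.
- move=> E f mE bf; rewrite -(Radon_Nikodym_change_of_variables numu)//.
    apply: eq_integral => x _; rewrite EFinM; congr (_ * _).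
    by rewrite -/dp [in RHS]dpE.
  exact: bmeas_integrable.
Qed.

Lemma sqnorm_density_with (nu mu : probability T R) (p : T -> R) :
  bmeas setT p ->
  (forall A, measurable A -> nu A = \int[mu]_(x in A) (p x)%:E) ->
  sqnorm_density nu mu = \int[mu]_x (p x ^+ 2)%:E /\
  forall E f, measurable E -> bmeas E f ->
    \int[mu]_(x in E) (f x * p x)%:E = \int[nu]_(x in E) (f x)%:E.
Proof.
move=> bp nuE; have mp : measurable_fun setT p by case: bp.
have numu : nu `<< mu.
  apply/null_content_dominatesP => A mA muA.
  by rewrite nuE// null_set_integral//; exact/measurable_EFinP/measurable_funTS.
have [p' [ip' -> p'f]] := sqnorm_densityP numu.
have mp' : measurable_fun setT p' by apply/measurable_EFinP; case/integrableP: ip'.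
have pp' : ae_eq mu setT (EFin \o p') (EFin \o p).
  apply: integral_ae_eq => //; first exact/measurable_EFinP.
  move=> A _ mA; rewrite -nuE//.
  have := p'f A (fun=> 1%R) mA (bmeas_cst A 1%R).
  rewrite integral_cst// mul1e => <-.
  by apply: eq_integral => x _; rewrite mul1r.
split.
  apply: ae_eq_integral => //; [| |].
  - exact/measurable_EFinP/measurable_funX.
  - exact/measurable_EFinP/measurable_funX.
  - by move: pp'; apply: filterS => x /= pp /pp [->].
move=> E f mE bf; rewrite -p'f//; have mf : measurable_fun E f by case: bf.
apply: ae_eq_integral => //.
- by apply/measurable_EFinP; apply: measurable_funM => //; exact: measurable_funTS.
- by apply/measurable_EFinP; apply: measurable_funM => //; exact: measurable_funTS.
- by move: pp'; apply: filterS => x /= pp Ex; have [->] := pp I.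
Qed.

End integral_tools.

(** Integrals against a marginal. *)
Lemma Rintegral_marginal (R : realType) d (T : measurableType d) d' (T' : measurableType d') (pi : probability T' R)
    (P : probability T R) (phi : T' -> T) (D : set T) (D' : set T') (f : T -> R) :
  measurable_fun setT phi -> measurable D -> measurable D' ->
  P D = 1%E -> pi D' = 1%E -> (forall z, D' z -> D (phi z)) ->
  (forall A, measurable A -> pi (phi @^-1` A) = P A) -> bmeas D f ->
  \int[pi]_(z in D') f (phi z) = \int[P]_(x in D) f x.
Proof.
move=> mphi mD mD' PD piD' DD piP bf.
have mF : measurable_fun setT (EFin \o (f \_ D)).
  by apply/measurable_EFinP/(measurable_restrictT _ mD); case: bf.
have mFphi := measurableT_comp mF mphi.
have iF : P.-integrable setT (EFin \o (f \_ D)).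
  by rewrite -restrict_EFin; apply/integrable_restrict => //; rewrite setTI; exact: bmeas_integrable.
rewrite /Rintegral; congr fine.
transitivity (\int[pi]_z ((f \_ D) (phi z))%:E)%E.
  rewrite (integral_full mD' piD' mFphi); apply: eq_integral => z; rewrite inE => D'z.
  by rewrite /= patchE mem_set//; exact: DD.
have -> : (\int[P]_(x in D) (f x)%:E = \int[P]_x ((f \_ D) x)%:E)%E.
  rewrite (integral_full mD PD mF); apply: eq_integral => x xD.
  by rewrite /= patchE xD.
have iFphi : pi.-integrable setT ((EFin \o (f \_ D)) \o phi).
  apply/integrableP; split => //.
  have [_ [M fM]] := bf.
  apply: (@le_lt_trans _ _ (\int[pi]_z `|M|%:E)%E).
    apply: ge0_le_integral => //=.
      by apply/measurable_EFinP; apply: measurableT_comp => //; exact/measurable_EFinP.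
    move=> z _; rewrite lee_fin patchE; case: ifPn => [/set_mem Dz|_].
      by rewrite (le_trans (fM _ Dz))// ler_norm.
    by rewrite normr0.
  by rewrite integral_cst// ltey_eq fin_numM// fin_num_measure.
transitivity (\int[pushforward pi phi]_x (EFin \o (f \_ D)) x)%E.
  by rewrite (integral_pushforward mphi).
by apply: eq_measure_integral => A mA _; exact: piP.
Qed.

Section with_density.
Context (R : realType) d (T : measurableType d) (mu : probability T R) (p : T -> R).
Local Open Scope ereal_scope.

(** The probability measure with density p with respect to mu; the proofs that
    p is a bounded probability density are arguments, so that the structure of
    probability measure can be attached to the definition. *)
Definition with_density (bp : bmeas setT p) (p0 : forall x, (0 <= p x)%R)
    (p1 : \int[mu]_x (p x)%:E = 1) : set T -> \bar R :=
  fun A => \int[mu]_(x in A) (p x)%:E.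

Hypotheses (bp : bmeas setT p) (p0 : forall x, (0 <= p x)%R)
  (p1 : \int[mu]_x (p x)%:E = 1).
Local Notation nu := (with_density bp p0 p1).

Let nu0 : nu set0 = 0. Proof. exact: integral_set0. Qed.

Let nu_ge0 A : 0 <= nu A.
Proof. by apply: integral_ge0 => x _; rewrite lee_fin. Qed.

Let nu_sigma_additive : semi_sigma_additive nu.
Proof.
apply: semi_sigma_additive_nng_induced; last by move=> x; rewrite lee_fin.
by apply/measurable_EFinP; case: bp.
Qed.

HB.instance Definition _ :=
  isMeasure.Build _ _ _ nu nu0 nu_ge0 nu_sigma_additive.

HB.instance Definition _ := Measure_isProbability.Build _ _ _ nu p1.

End with_density.

Lemma duality_arith (R : realFieldType) (o u s k p i : R) :
  u <= s -> s <= k + p -> p <= i -> o - k <= o - u + i.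
Proof. lra. Qed.

Section duality.
Context (R : realType) (d : nat).
Local Notation Rd := ('rV[R]_d).
Variables (P Q : probability Rd R) (c : Rd -> Rd -> R) (eps : R).
Local Notation Om := (supp P).
Local Notation Om' := (supp Q).
Hypotheses (eps0 : 0 < eps) (mOm : measurable Om) (mOm' : measurable Om').
Hypothesis mc : measurable_fun setT (fun z : Rd * Rd => c z.1 z.2).
Hypothesis bc : bmeas (Om `*` Om') (fun z => c z.1 z.2).

Local Notation Gam := (Gamma P Q c eps).
Local Notation PQ := (P \x Q)%E.
Local Notation D := (Om `*` Om').

Let PE : P Om = 1%E. Proof. exact: probability_supp. Qed.
Let QE : Q Om' = 1%E. Proof. exact: probability_supp. Qed.
Let mD : measurable D. Proof. exact: measurableX. Qed.

Let coupling_full (pi : probability (Rd * Rd)%type R) :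
  is_coupling P Q pi -> pi D = 1%E.
Proof.
move=> cpi; have [piP _] := cpi _ mOm; have [_ piQ] := cpi _ mOm'.
have mX : measurable (Om `*` [set: Rd]) by exact: measurableX.
have mY : measurable ([set: Rd] `*` Om') by exact: measurableX.
have -> : D = (Om `*` setT) `&` (setT `*` Om').
  by apply/seteqP; split=> [[x y] [? ?]|[x y] [[? _] [_ ?]]].
by rewrite probability_setI1//; [rewrite piP|rewrite piQ].
Qed.

Let coupling_fst (pi : probability (Rd * Rd)%type R) f : is_coupling P Q pi ->
  bmeas Om f -> \int[pi]_(z in D) f z.1 = \int[P]_(x in Om) f x.
Proof.
move=> cpi bf.
apply: (Rintegral_marginal measurable_fst mOm mD PE (coupling_full cpi)) => //.
  by move=> z [].
move=> A mA; rewrite -(cpi A mA).1; congr (pi _).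
by apply/seteqP; split=> [z|z []].
Qed.

Let coupling_snd (pi : probability (Rd * Rd)%type R) g : is_coupling P Q pi ->
  bmeas Om' g -> \int[pi]_(z in D) g z.2 = \int[Q]_(y in Om') g y.
Proof.
move=> cpi bg.
apply: (Rintegral_marginal measurable_snd mOm' mD QE (coupling_full cpi)) => //.
  by move=> z [].
move=> A mA; rewrite -(cpi A mA).2; congr (pi _).
by apply/seteqP; split=> [z|z []].
Qed.

Let coupling_cost (pi : probability (Rd * Rd)%type R) : is_coupling P Q pi ->
  (\int[pi]_z (c z.1 z.2)%:E)%E = (\int[pi]_(z in D) c z.1 z.2)%:E.
Proof.
move=> cpi; rewrite (integral_full mD (coupling_full cpi)); last exact/measurable_EFinP.
exact: EFin_RintegralE.
Qed.

(** Weak duality, from Young's inequality s p <= s^2 / (2 eps) + eps p^2 / 2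
    for s the positive part of f + g - c and p the density of the coupling. *)
Lemma weak_duality f g (pi : probability (Rd * Rd)%type R) :
  bmeas Om f -> bmeas Om' g -> is_coupling P Q pi ->
  ((Gam f g)%:E <= \int[pi]_z (c z.1 z.2)%:E
                 + (eps / 2)%:E * sqnorm_density pi PQ)%E.
Proof.
move=> bf bg cpi; rewrite coupling_cost//; have e20 : 0 < eps / 2 by rewrite divr_gt0.
have [piPQ|npiPQ] := pselect (pi `<< PQ); last first.
  by rewrite /sqnorm_density asboolF// gt0_muley ?lte_fin// addey// leey.
have [p [ip -> pi_p]] := sqnorm_densityP piPQ.
have mp : measurable_fun setT p by apply/measurable_EFinP; case/integrableP: ip.
set I := (\int[_]_x _)%E.
have I0 : (0 <= I)%E by apply: integral_ge0 => z _; rewrite lee_fin sqr_ge0.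
have [Ioo|Ifin] := eqVneq I +oo%E.
  by rewrite Ioo gt0_muley ?lte_fin// addey// leey.
have {}Ifin : (I < +oo)%E by rewrite ltey.
have bs := bmeas_slack mOm mOm' bc bf bg.
have bo := bmeas_oplus mOm mOm' bf bg.
have bu : bmeas D (fun z => oplus f g z - c z.1 z.2) by exact: bmeasB.
have cE : \int[pi]_(z in D) c z.1 z.2 = \int[PQ]_(z in D) oplus f g z -
    \int[pi]_(z in D) (oplus f g z - c z.1 z.2).
  rewrite (bRintegralB pi mD bo bc) opprB addrCA.
  rewrite /oplus (bRintegralD PQ mD (bmeas_fst mOm mOm' bf) (bmeas_snd mOm mOm' bg)).
  rewrite (bRintegral_fst P mOm mOm' QE bf) (bRintegral_snd Q mOm mOm' PE bg).
  rewrite (bRintegralD pi mD (bmeas_fst mOm mOm' bf) (bmeas_snd mOm mOm' bg)).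
  by rewrite coupling_fst// coupling_snd// subrr addr0.
(* Passing to the positive part before changing the measure makes the sign of the
   chosen version of the density irrelevant. *)
have us : \int[pi]_(z in D) (oplus f g z - c z.1 z.2) <= \int[pi]_(z in D) slack c f g z.
  by apply: ler_bRintegral => // z _; rewrite /slack le_max lexx.
have ip2 : PQ.-integrable setT (EFin \o (fun z => p z ^+ 2)).
  apply/integrableP; split.
    by apply/measurable_EFinP; exact: measurable_funX.
  by under eq_integral do rewrite /= ger0_norm ?sqr_ge0//.
have bs2 := bmeasX 2 bs.
have iD2 : PQ.-integrable D (EFin \o (fun z => p z ^+ 2)).
  exact: (integrableS measurableT mD).
pose h z := (2 * eps)^-1 * slack c f g z ^+ 2 + eps / 2 * p z ^+ 2.
have i1 := bmeas_integrable PQ mD (bmeasZ (2 * eps)^-1 bs2).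
have i2 : PQ.-integrable D (EFin \o (fun z => eps / 2 * p z ^+ 2)).
  by apply: eq_integrable (integrableZl mD (eps / 2) iD2) => // z _; rewrite /= EFinM.
have ih : PQ.-integrable D (EFin \o h).
  by apply: eq_integrable (integrableD mD i1 i2) => // z _; rewrite /h /= EFinD.
have s0 z : 0 <= slack c f g z by exact: slack_ge0.
have sph z : `|slack c f g z * p z| <= h z.
  rewrite /h normrM (ger0_norm (s0 z)) -(real_normK (num_real (p z))).
  move: (slack c f g z) (`|p z|) => a b.
  have : 0 <= (2 * eps)^-1 * (a - eps * b) ^+ 2.
    by rewrite mulr_ge0 ?sqr_ge0// invr_ge0 mulr_ge0// ltW.
  have -> : (2 * eps)^-1 * (a - eps * b) ^+ 2 =
      (2 * eps)^-1 * a ^+ 2 + eps / 2 * b ^+ 2 - a * b by field; exact: lt0r_neq0.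
  by rewrite subr_ge0.
have isp : PQ.-integrable D (EFin \o (fun z => slack c f g z * p z)).
  apply: (le_integrable mD _ _ ih).
    apply/measurable_EFinP; apply: measurable_funM; first by case: bs.
    exact: measurable_funTS.
  by move=> z _ /=; rewrite lee_fin (le_trans (sph z))// ler_norm.
have sE : \int[pi]_(z in D) slack c f g z = \int[PQ]_(z in D) (slack c f g z * p z).
  by rewrite /Rintegral pi_p.
have le_h : \int[PQ]_(z in D) (slack c f g z * p z) <= \int[PQ]_(z in D) h z.
  by apply: le_Rintegral => // z _; exact: le_trans (ler_norm _) (sph z).
have hE : \int[PQ]_(z in D) h z = (2 * eps)^-1 * \int[PQ]_(z in D) (slack c f g z ^+ 2)
    + eps / 2 * \int[PQ]_(z in D) (p z ^+ 2).
  by rewrite (RintegralD mD i1 i2) (bRintegralZ PQ mD _ bs2) (RintegralZl (eps / 2) mD iD2).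
have Ifin' : I \is a fin_num by rewrite ge0_fin_numE.
have p2I : \int[PQ]_(z in D) (p z ^+ 2) <= fine I.
  rewrite fine_le//; first exact: integrable_fin_num.
  apply: ge0_subset_integral => //; first exact: (measurable_int PQ ip2).
  by move=> z _; rewrite lee_fin sqr_ge0.
rewrite -(fineK Ifin') -EFinM -EFinD lee_fin cE /Gamma.
rewrite (bRintegralB PQ mD bo (bmeasZ _ bs2)) (bRintegralZ PQ mD _ bs2).
have eI : eps / 2 * \int[PQ]_(z in D) (p z ^+ 2) <= eps / 2 * fine I.
  by rewrite ler_wpM2l// ltW.
rewrite sE in us; rewrite hE in le_h.
by refine (@duality_arith R (\int[PQ]_(z in D) oplus f g z) _ _ _ _ _ us le_h eI).
Qed.

(** Strong duality at a critical point of the dual objective: the first-order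
    conditions say that s / eps, with s the positive part of f + g - c, is the
    density of a coupling, for which Young's inequality is an equality. *)
Lemma QOT_dual f g : bmeas Om f -> bmeas Om' g ->
  (forall x, Om x -> D1Gamma Q c eps f g x = 0) ->
  (forall y, Om' y -> D2Gamma P c eps f g y = 0) ->
  QOT P Q c eps = (Gam f g)%:E.
Proof.
move=> bf bg foc1 foc2.
have bs := bmeas_slack mOm mOm' bc bf bg.
have bo := bmeas_oplus mOm mOm' bf bg.
pose q z := eps^-1 * slack c f g z; pose p := q \_ D.
have bq : bmeas D q by exact: bmeasZ.
have q0 z : 0 <= q z by rewrite mulr_ge0 ?slack_ge0// invr_ge0 ltW.
have p0 z : 0 <= p z by rewrite /p patchE; case: ifP.
have bp : bmeas setT p.
  split; first by apply/(measurable_restrictT _ mD); case: bq.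
  have [_ [M qM]] := bq; exists `|M| => z _; rewrite /p patchE.
  case: ifPn => [/set_mem Dz|_]; last by rewrite normr0.
  by rewrite (le_trans (qM _ Dz))// ler_norm.
have q1x x : Om x -> \int[Q]_(y in Om') q (x, y) = 1.
  move=> Ox; have bsx := bmeas_sectionl mOm mOm' Ox bs.
  rewrite (bRintegralZ Q mOm' _ bsx); have /eqP := foc1 x Ox.
  by rewrite subr_eq0 => /eqP <-.
have q1y y : Om' y -> \int[P]_(x in Om) q (x, y) = 1.
  move=> Oy; have bsy := bmeas_sectionr mOm mOm' Oy bs.
  rewrite (bRintegralZ P mOm _ bsy); have /eqP := foc2 y Oy.
  by rewrite subr_eq0 => /eqP <-.
have pI A B : measurable A -> measurable B ->
    (\int[PQ]_(z in A `*` B) (p z)%:E)%E =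
    (\int[PQ]_(z in (A `&` Om) `*` (B `&` Om')) q z)%:E.
  move=> mA mB; have mAB : measurable ((A `&` Om) `*` (B `&` Om')).
    by apply: measurableX; exact: measurableI.
  have sub : (A `&` Om) `*` (B `&` Om') `<=` D by move=> z [[_ ?] [_ ?]].
  have bq' : bmeas ((A `&` Om) `*` (B `&` Om')) q.
    split; first exact: measurable_funS mD sub bq.1.
    by have [_ [M qM]] := bq; exists M => z /sub; exact: qM.
  rewrite -EFin_RintegralE// integral_mkcond [RHS]integral_mkcond.
  apply: eq_integral => z _; rewrite !patchE /p patchE.
  have -> : (z \in (A `&` Om) `*` (B `&` Om')) = (z \in A `*` B) && (z \in D).
    apply/idP/andP; rewrite !inE; first by move=> [[? ?] [? ?]].
    by move=> [[? ?] [? ?]].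
  by case: (z \in A `*` B); case: (z \in D).
have mg1 A : measurable A -> (\int[PQ]_(z in A `*` setT) (p z)%:E)%E = P A.
  move=> mA; rewrite pI// setTI.
  have mAO : measurable (A `&` Om) by exact: measurableI.
  have bq' : bmeas ((A `&` Om) `*` Om') q.
    have sub : (A `&` Om) `*` Om' `<=` D by move=> z [[_ ?] ?].
    split; first exact: measurable_funS mD sub bq.1.
    by have [_ [M qM]] := bq; exists M => z /sub; exact: qM.
  rewrite (bRintegral_prodl P Q mAO mOm' bq').2.
  rewrite (@eq_bRintegral _ _ _ P _ _ (fun=> 1)); last by move=> x [_ Ox]; exact: q1x.
  rewrite Rintegral_cst// mul1r fineK ?fin_num_measure//.
  exact: probability_setI1.
have mg2 A : measurable A -> (\int[PQ]_(z in setT `*` A) (p z)%:E)%E = Q A.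
  move=> mA; rewrite pI// setTI.
  have mAO : measurable (A `&` Om') by exact: measurableI.
  have bq' : bmeas (Om `*` (A `&` Om')) q.
    have sub : Om `*` (A `&` Om') `<=` D by move=> z [? [_ ?]].
    split; first exact: measurable_funS mD sub bq.1.
    by have [_ [M qM]] := bq; exists M => z /sub; exact: qM.
  rewrite (bRintegral_prodr P Q mOm mAO bq').2.
  rewrite (@eq_bRintegral _ _ _ Q _ _ (fun=> 1)); last by move=> x [_ Ox]; exact: q1y.
  rewrite Rintegral_cst// mul1r fineK ?fin_num_measure//.
  exact: probability_setI1.
have p1 : (\int[PQ]_z (p z)%:E)%E = 1%E.
  by rewrite -setXTT mg1//; exact: probability_setT.
pose pi : probability (Rd * Rd)%type R := with_density bp p0 p1.
have piE A : measurable A -> pi A = (\int[PQ]_(z in A) (p z)%:E)%E by [].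
have cpi : is_coupling P Q pi.
  move=> A mA; split; [exact: mg1|exact: mg2].
have [sqE pif] := sqnorm_density_with bp piE.
apply/eqP; rewrite eq_le; apply/andP; split; last first.
  by apply: le_ereal_inf_tmp => _ [pi' cpi' <-]; exact: weak_duality.
apply: ge_ereal_inf; eexists; first by exists pi; [exact: cpi|reflexivity].
rewrite coupling_cost// -EFin_RintegralE// -pif// sqE.
have -> : (\int[PQ]_z (p z ^+ 2)%:E = (\int[PQ]_(z in D) (q z ^+ 2))%:E)%E.
  rewrite -EFin_RintegralE//; last exact: bmeasX.
  rewrite [RHS]integral_mkcond; apply: eq_integral => z _.
  by rewrite patchE /p patchE; case: ifP; rewrite // expr0n.
have bcq : bmeas D (fun z => c z.1 z.2 * q z) by exact: bmeasM.
have -> : (\int[PQ]_(z in D) (c z.1 z.2 * p z)%:E = (\int[PQ]_(z in D) (c z.1 z.2 * q z))%:E)%E.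
  rewrite -EFin_RintegralE//.
  by apply: eq_integral => z zD; rewrite /p patchE zD.
have bq2 := bmeasX 2 bq.
rewrite -EFinM -EFinD lee_fin -(bRintegralZ PQ mD _ bq2) -(bRintegralD PQ mD bcq (bmeasZ _ bq2)).
have dG : \int[PQ]_(z in D) ((1 - q z) * oplus f g z) = 0.
  rewrite -(dGammaE eps mOm mOm' bc bf bg bf bg) /dGamma.
  rewrite (@eq_bRintegral _ _ _ P _ _ (fun=> 0)); last by move=> x Ox; rewrite foc1// mul0r.
  rewrite (@eq_bRintegral _ _ _ Q _ _ (fun=> 0)); last by move=> y Oy; rewrite foc2// mul0r.
  by rewrite !Rintegral_cst// !mul0r addr0.
have bdG : bmeas D (fun z => (1 - q z) * oplus f g z).
  by apply: bmeasM => //; apply: bmeasB => //; exact: bmeas_cst.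
have bcq2 := bmeasD bcq (bmeasZ (eps / 2) bq2).
rewrite -[leLHS]addr0 -dG -(bRintegralD PQ mD bcq2 bdG) /Gamma.
rewrite le_eqVlt; apply/orP; left; apply/eqP; apply: eq_bRintegral => z _.
rewrite /q -/(slack c f g z).
have su : slack c f g z ^+ 2 = slack c f g z * (oplus f g z - c z.1 z.2).
  rewrite /slack; case: (leP (oplus f g z - c z.1 z.2) 0) => _; last by rewrite expr2.
  by rewrite expr0n mul0r.
rewrite exprMn su; move: (slack c f g z) (oplus f g z) (c z.1 z.2) => s o k.
by field; exact: lt0r_neq0.
Qed.

End duality.

(** * Regularity of the cost and of the potentials *)

Section regularity.
Context (R : realType) (d : nat).
Local Notation Rd := ('rV[R]_d).

Lemma lipschitz_continuous_rV n (K : R) (C : 'rV[R]_n -> R) : 0 <= K ->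
  (forall (w w' : 'rV[R]_n) (s : R), 0 < s -> (forall i, `|w ord0 i - w' ord0 i| < s) ->
    `|C w - C w'| <= K * s) ->
  continuous C.
Proof.
move=> K0 CK w A /nbhs_ballP[e /= e0 eA].
have K1 : 0 < K + 1 by rewrite (le_lt_trans K0)// ltrDl.
have s0 : 0 < e / (K + 1) by rewrite divr_gt0.
apply/nbhs_ballP; exists (e / (K + 1)) => //= w' /(rV_ballP _ _ s0) ww'.
apply: eA; apply: (le_lt_trans (CK _ _ _ s0 ww')).
by rewrite mulrA ltr_pdivrMr// mulrDr mulr1 mulrC ltrDl.
Qed.

Lemma continuous_measurable_rV n (C : 'rV[R]_n -> R) :
  continuous C -> measurable_fun setT C.
Proof.
move=> cC; apply: (measurability _ (@RGenOpens.measurableE R)).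
move=> _ [_ [a [b ->]] <-]; rewrite setTI; apply: open_measurable_rV.
by apply: open_comp; [move=> x _; exact: cC|exact: interval_open].
Qed.

Variables (L : R) (c : Rd -> Rd -> R).
Hypotheses (L0 : 0 < L) (hc : elipschitz2 L c).

(* 283/200 is a rational upper bound for the square root of 2. *)
Lemma sqrt_sqrD_le (a b t : R) : 0 <= t -> 0 <= a <= t -> 0 <= b <= t ->
  Num.sqrt (a ^+ 2 + b ^+ 2) <= 283 / 200 * t.
Proof.
move=> t0 /andP[a0 at_] /andP[b0 bt].
have -> : 283 / 200 * t = Num.sqrt ((283 / 200 * t) ^+ 2).
  by rewrite sqrtr_sqr ger0_norm// mulr_ge0.
by rewrite ler_wsqrtr//; nra.
Qed.

(** The cost is measurable for the product sigma-algebra: it is a continuous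
    function of the concatenation of its arguments in R^(d + d). *)
Lemma measurable_cost : measurable_fun setT (fun z : Rd * Rd => c z.1 z.2).
Proof.
pose C (w : 'rV[R]_(d + d)) := c (lsubmx w) (rsubmx w).
rewrite (_ : (fun z => _) = C \o (fun z : Rd * Rd => row_mx z.1 z.2)); last first.
  by apply/funext => -[x y]; rewrite /C/= row_mxKl row_mxKr.
apply: measurableT_comp.
  apply: continuous_measurable_rV.
  apply: (@lipschitz_continuous_rV _ (L * (283 / 200 * d%:R))).
    by rewrite !mulr_ge0// ltW.
  move=> w w' s s0 ww'; apply: (le_trans (hc _ _ _ _)).
  rewrite -mulrA ler_wpM2l ?(ltW L0)//.
  rewrite (_ : _ * _ * s = 283 / 200 * (d%:R * s)); last by rewrite !mulrA.
  apply: sqrt_sqrD_le; first by rewrite mulr_ge0// ltW.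
  - rewrite enorm_ge0/=; apply: enorm_le_coord; first exact: ltW.
    by move=> i; rewrite !mxE ltW.
  - rewrite enorm_ge0/=; apply: enorm_le_coord; first exact: ltW.
    by move=> i; rewrite !mxE ltW.
apply: measurable_fun_coordP => i; case: (fintype.splitP i) => j ij.
  rewrite (_ : (fun _ => _) = (fun z : Rd * Rd => z.1 ord0 j)).
    exact: (measurableT_comp (measurable_coord j) measurable_fst).
  by apply/funext => z; rewrite (_ : i = lshift d j) ?row_mxEl//; exact: val_inj.
rewrite (_ : (fun _ => _) = (fun z : Rd * Rd => z.2 ord0 j)).
  exact: (measurableT_comp (measurable_coord j) measurable_snd).
by apply/funext => z; rewrite (_ : i = rshift d j) ?row_mxEr//; exact: val_inj.
Qed.

Lemma bmeas_cost (A B : set Rd) : compact A -> compact B ->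
  bmeas (A `*` B) (fun z => c z.1 z.2).
Proof.
move=> cA cB; split; first by apply: measurable_funTS; exact: measurable_cost.
have [M M0 AM] := enorm_bounded cA; have [N N0 BN] := enorm_bounded cB.
have [[[x0 y0] [/= Ax0 By0]]|nAB] := pselect (A `*` B !=set0); last first.
  by exists 0 => z ABz; exfalso; apply: nAB; exists z.
exists (`|c x0 y0| + L * (283 / 200 * (M + N))) => -[x y] [/= Ax By].
rewrite -[c x y](subrK (c x0 y0)) addrC (le_trans (ler_normD _ _))// lerD2l.
apply: (le_trans (hc _ _ _ _)); rewrite ler_wpM2l ?(ltW L0)//.
apply: sqrt_sqrD_le; first exact: addr_ge0.
- by rewrite enorm_ge0/= (le_trans (AM _ _ Ax Ax0))// lerDl.
- by rewrite enorm_ge0/= (le_trans (BN _ _ By By0))// lerDr.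
Qed.

Lemma bmeas_lipschitz (A : set Rd) (f : Rd -> R) : compact A ->
  measurable_fun A f -> elipschitz_on A L f -> bmeas A f.
Proof.
move=> cA mf lf; split => //; have [M M0 AM] := enorm_bounded cA.
have [[x0 Ax0]|nA] := pselect (A !=set0); last first.
  by exists 0 => z Az; exfalso; apply: nA; exists z.
exists (`|f x0| + L * M) => x Ax.
rewrite -[f x](subrK (f x0)) addrC (le_trans (ler_normD _ _))// lerD2l.
by rewrite (le_trans (lf _ _ Ax Ax0))// ler_wpM2l ?AM// ltW.
Qed.

Lemma measurable_L2_supp (mu : probability Rd R) (f : Rd -> R) :
  measurable (supp mu) -> L2_supp mu f -> measurable_fun (supp mu) f.
Proof.
move=> mS; rewrite /L2_supp inE => /andP[+ _]; rewrite inE /= => mf.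
exact/(measurable_restrictT _ mS).
Qed.

Lemma bmeas_L2_supp (mu : probability Rd R) (f : Rd -> R) :
  measurable (supp mu) -> bmeas (supp mu) f -> L2_supp mu f.
Proof.
move=> mS [mf [M fM]]; rewrite /L2_supp.
have mF : measurable_fun setT (f \_ (supp mu)) by exact/(measurable_restrictT _ mS).
rewrite inE; apply/andP; split; rewrite inE//= /finite_norm.
rewrite ltey; apply/eqP => Noo.
have := sqr_Lnorm2 mu (f \_ (supp mu)); rewrite Noo expe2 mulyy => /esym.
apply/eqP; rewrite -ltey.
apply: (@le_lt_trans _ _ (\int[mu]_z (`|M| ^+ 2)%:E)%E).
  apply: ge0_le_integral => //=.
  - by move=> x _; rewrite lee_fin sqr_ge0.
  - exact/measurable_EFinP/measurable_funX.
  - move=> x _; rewrite lee_fin patchE; case: ifPn => [/set_mem Sx|_].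
      rewrite -(real_normK (num_real (f x))) lerXn2r ?nnegrE//.
      by rewrite (le_trans (fM _ Sx))// ler_norm.
    by rewrite expr0n/= sqr_ge0.
by rewrite integral_cst// ltey_eq fin_numM// fin_num_measure.
Qed.

Lemma bmeas_Linfty_supp (mu : probability Rd R) (f : Rd -> R) :
  Linfty_supp mu f -> bmeas (supp mu) f.
Proof.
move=> [mf [M [_ fM]]]; split => //; exists (M + 1) => x Sx; apply: fM => //.
by rewrite ltrDl.
Qed.

End regularity.

(** * First-order conditions and uniform bounds *)

Lemma max0_shift (R : realDomainType) (u v k : R) :
  0 <= k -> u <= v + k -> Num.max u 0 <= Num.max v 0 + k.
Proof.
move=> k0 uvk; rewrite ge_max addr_ge0 ?andbT ?le_max ?lexx ?orbT//.
by rewrite (le_trans uvk)// lerD2r le_max lexx.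
Qed.

(** The increments of the positive part, tested against the increments of the
    argument, control the squares of the latter where the argument is positive. *)
Lemma max0_monotone_ge0 (R : realFieldType) (u v : R) :
  0 <= (Num.max v 0 - Num.max u 0) * (v - u).
Proof.
have [u0|u0] := leP u 0; have [v0|v0] := leP v 0.
- by rewrite subrr mul0r.
- by rewrite subr0 mulr_ge0//; lra.
- by rewrite sub0r mulNr oppr_ge0 mulr_ge0_le0//; lra.
- by rewrite -expr2 sqr_ge0.
Qed.

Lemma max0_monotone_lb (R : realFieldType) (u v t M : R) :
  0 <= t -> t <= M -> t <= u -> `|v - u| <= M ->
  t * (v - u) ^+ 2 <= M * ((Num.max v 0 - Num.max u 0) * (v - u)).
Proof.
move=> t0 tM tu vuM; have M0 := le_trans t0 tM.
rewrite (max_idPl (le_trans t0 tu)).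
have [v0|v0] := leP v 0; last first.
  by rewrite -expr2 ler_wpM2r ?sqr_ge0.
have vu : v - u <= 0 by lra.
move: vuM; rewrite ler0_norm// => vuM.
rewrite sub0r (_ : _ ^+ 2 = - (v - u) * - (v - u)); last by ring.
rewrite (_ : M * _ = M * u * - (v - u)); last by ring.
rewrite mulrA ler_wpM2r ?oppr_ge0// mulrC; apply: ler_pM => //; lra.
Qed.

Section optimal_potentials.
Context (R : realType) (d : nat).
Local Notation Rd := ('rV[R]_d).
Variables (P Q : probability Rd R) (c : Rd -> Rd -> R) (eps : R).
Local Notation Om := (supp P).
Local Notation Om' := (supp Q).
Hypotheses (eps0 : 0 < eps) (cP : compact Om) (cQ : compact Om').
Variable L : R.
Hypotheses (L0 : 0 < L) (hc : elipschitz2 L c).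
Implicit Types f g : Rd -> R.

Local Notation Gam := (Gamma P Q c eps).
Local Notation D1 := (D1Gamma Q c eps).
Local Notation D2 := (D2Gamma P c eps).
Local Notation PQ := (P \x Q)%E.
Local Notation D := (Om `*` Om').

Let mOm : measurable Om. Proof. exact: compact_measurable_rV. Qed.
Let mOm' : measurable Om'. Proof. exact: compact_measurable_rV. Qed.
Let PE : P Om = 1%E. Proof. exact: probability_supp. Qed.
Let QE : Q Om' = 1%E. Proof. exact: probability_supp. Qed.
Let mD : measurable D. Proof. exact: measurableX. Qed.
Let bc : bmeas D (fun z => c z.1 z.2). Proof. exact: (bmeas_cost L0 hc). Qed.

(** A Lipschitz function with vanishing quadratic mean vanishes on the support. *)
Lemma lipschitz_null (mu : probability Rd R) (h : Rd -> R) (K : R) :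
  measurable (supp mu) -> 0 < K -> bmeas (supp mu) h ->
  elipschitz_on (supp mu) K h ->
  \int[mu]_(x in supp mu) (h x ^+ 2) <= 0 -> forall x, supp mu x -> h x = 0.
Proof.
move=> mS K0 bh lh int0 x0 Sx0; apply/eqP/negPn/negP => h0.
have s0 : 0 < `|h x0| by rewrite normr_gt0.
pose r := `|h x0| / (2 * K); have r0 : 0 < r by rewrite divr_gt0// mulr_gt0.
have mB : measurable (eball x0 r) by exact: measurable_eball.
have := @markov_Rintegral _ _ _ mu _ mS (fun x => h x ^+ 2) ((`|h x0| / 2) ^+ 2) (eball x0 r) (bmeasX 2 bh).
move=> /(_ (fun x _ => sqr_ge0 _) mB) => H.
have : (`|h x0| / 2) ^+ 2 * fine (mu (supp mu `&` eball x0 r)) <= 0.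
  apply: le_trans int0; apply: H => x Sx xx0.
  rewrite -(real_normK (num_real (h x))) lerXn2r ?nnegrE// ?divr_ge0//.
  have := lh _ _ Sx0 Sx.
  have : K * enorm (x0 - x) <= `|h x0| / 2.
    rewrite enormC; apply: (le_trans (ler_wpM2l (ltW K0) (ltW xx0))).
    by rewrite /r le_eqVlt; apply/orP; left; apply/eqP; field; exact: lt0r_neq0.
  have := ler_normD (h x) (h x0 - h x); rewrite (_ : h x + (h x0 - h x) = h x0); last by ring.
  by lra.
rewrite leNgt => /negP; apply; rewrite mulr_gt0 ?exprn_gt0 ?divr_gt0//.
rewrite setIC probability_setI1//; last exact: probability_supp.
by rewrite fine_gt0// Sx0//= -ge0_fin_numE// fin_num_measure.
Qed.

Lemma D1_lipschitz f g : bmeas Om f -> bmeas Om' g -> elipschitz_on Om L f ->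
  elipschitz_on Om (eps^-1 * (2 * L)) (D1 f g).
Proof.
move=> bf bg lf x x' Ox Ox'; have bs := bmeas_slack mOm mOm' bc bf bg.
have bx := bmeas_sectionl mOm mOm' Ox bs; have bx' := bmeas_sectionl mOm mOm' Ox' bs.
rewrite (_ : D1 f g x - D1 f g x' = eps^-1 *
    \int[Q]_(y in Om') (slack c f g (x', y) - slack c f g (x, y))); last first.
  by rewrite (bRintegralB Q mOm' bx' bx) /D1Gamma /slack /oplus /=; ring.
rewrite normrM ger0_norm ?invr_ge0 ?(ltW eps0)// -mulrA ler_wpM2l ?invr_ge0 ?(ltW eps0)//.
have sl y : `|slack c f g (x', y) - slack c f g (x, y)| <= 2 * L * enorm (x - x').
  apply: (le_trans (max0_lip _ _)); rewrite /oplus /=.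
  rewrite (_ : _ - _ - _ = (f x' - f x) - (c x' y - c x y)); last by ring.
  apply: (le_trans (ler_normB _ _)).
  rewrite (_ : 2 * L * _ = L * enorm (x - x') + L * enorm (x - x')); last by ring.
  apply: lerD; first by rewrite distrC lf.
  rewrite distrC (le_trans (hc _ _ _ _))// subrr enorm0 expr0n addr0 sqrtr_sqr.
  by rewrite ger0_norm// enorm_ge0.
have bxx := bmeasB bx' bx.
rewrite ler_norml; apply/andP; split.
  apply: Rintegral_lb => // y Oy.
  by have := sl y; rewrite ler_norml => /andP[].
by apply: Rintegral_ub => // y Oy; have := sl y; rewrite ler_norml => /andP[].
Qed.

Lemma D2_lipschitz f g : bmeas Om f -> bmeas Om' g -> elipschitz_on Om' L g ->
  elipschitz_on Om' (eps^-1 * (2 * L)) (D2 f g).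
Proof.
move=> bf bg lg y y' Oy Oy'; have bs := bmeas_slack mOm mOm' bc bf bg.
have by_ := bmeas_sectionr mOm mOm' Oy bs; have by' := bmeas_sectionr mOm mOm' Oy' bs.
rewrite (_ : D2 f g y - D2 f g y' = eps^-1 *
    \int[P]_(x in Om) (slack c f g (x, y') - slack c f g (x, y))); last first.
  by rewrite (bRintegralB P mOm by' by_) /D2Gamma /slack /oplus /=; ring.
rewrite normrM ger0_norm ?invr_ge0 ?(ltW eps0)// -mulrA ler_wpM2l ?invr_ge0 ?(ltW eps0)//.
have sl x : `|slack c f g (x, y') - slack c f g (x, y)| <= 2 * L * enorm (y - y').
  apply: (le_trans (max0_lip _ _)); rewrite /oplus /=.
  rewrite (_ : _ - _ - _ = (g y' - g y) - (c x y' - c x y)); last by ring.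
  apply: (le_trans (ler_normB _ _)).
  rewrite (_ : 2 * L * _ = L * enorm (y - y') + L * enorm (y - y')); last by ring.
  apply: lerD; first by rewrite distrC lg.
  rewrite distrC (le_trans (hc _ _ _ _))// subrr enorm0 expr0n add0r sqrtr_sqr.
  by rewrite ger0_norm// enorm_ge0.
have byy := bmeasB by' by_.
rewrite ler_norml; apply/andP; split.
  apply: Rintegral_lb => // x Ox.
  by have := sl x; rewrite ler_norml => /andP[].
by apply: Rintegral_ub => // x Ox; have := sl x; rewrite ler_norml => /andP[].
Qed.

Variables fs gs : Rd -> R.
Hypotheses (bfs : bmeas Om fs) (bgs : bmeas Om' gs).
Hypotheses (lfs : elipschitz_on Om L fs) (lgs : elipschitz_on Om' L gs).
Hypothesis Gmax : forall f g, bmeas Om f -> bmeas Om' g -> Gam f g <= Gam fs gs.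

Let step_nonpos s : eps * (1 - eps / (2 * eps)) * s <= 0 -> s <= 0.
Proof.
rewrite (_ : eps * _ = eps / 2); last by field; exact: lt0r_neq0.
by rewrite pmulr_rle0// divr_gt0.
Qed.

(** The first-order conditions hold at every point of the supports, and not only
    almost everywhere, because the components of the gradient are Lipschitz. *)
Lemma first_order1 x : Om x -> D1 fs gs x = 0.
Proof.
have K0 : 0 < eps^-1 * (2 * L) by rewrite mulr_gt0 ?invr_gt0// mulr_gt0.
apply: (lipschitz_null mOm K0 (bmeas_D1 eps mOm mOm' bc bfs bgs) (D1_lipschitz bfs bgs lfs)).
apply: step_nonpos; have := Gamma_step1 eps0 mOm mOm' bc eps bfs bgs.
have bD1 := bmeas_D1 eps mOm mOm' bc bfs bgs.
have := Gmax (bmeasD bfs (bmeasZ eps bD1)) bgs.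
by move=> h1 h2; have := le_trans h2 h1; rewrite gerDl.
Qed.

Lemma first_order2 y : Om' y -> D2 fs gs y = 0.
Proof.
have K0 : 0 < eps^-1 * (2 * L) by rewrite mulr_gt0 ?invr_gt0// mulr_gt0.
apply: (lipschitz_null mOm' K0 (bmeas_D2 eps mOm mOm' bc bfs bgs) (D2_lipschitz bfs bgs lgs)).
apply: step_nonpos; have := Gamma_step2 eps0 mOm mOm' bc eps bfs bgs.
have bD2 := bmeas_D2 eps mOm mOm' bc bfs bgs.
have := Gmax bfs (bmeasD bgs (bmeasZ eps bD2)).
by move=> h1 h2; have := le_trans h2 h1; rewrite gerDl.
Qed.

Let slack1 x : Om x -> \int[Q]_(y in Om') slack c fs gs (x, y) = eps.
Proof.
move=> Ox; have /eqP := first_order1 Ox; rewrite subr_eq0 => /eqP.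
by move/(congr1 ( *%R eps)); rewrite mulr1 mulrA divff ?mul1r ?lt0r_neq0.
Qed.

Let slack2 y : Om' y -> \int[P]_(x in Om) slack c fs gs (x, y) = eps.
Proof.
move=> Oy; have /eqP := first_order2 Oy; rewrite subr_eq0 => /eqP.
by move/(congr1 ( *%R eps)); rewrite mulr1 mulrA divff ?mul1r ?lt0r_neq0.
Qed.

Let bss := bmeas_slack mOm mOm' bc bfs bgs.

Lemma D1E f g x : bmeas Om f -> bmeas Om' g -> Om x ->
  D1 f g x = eps^-1 * \int[Q]_(y in Om') (slack c fs gs (x, y) - slack c f g (x, y)).
Proof.
move=> bf bg Ox; have bs := bmeas_slack mOm mOm' bc bf bg.
rewrite (bRintegralB Q mOm' (bmeas_sectionl mOm mOm' Ox bss) (bmeas_sectionl mOm mOm' Ox bs)).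
by rewrite slack1// mulrBr mulVf ?lt0r_neq0.
Qed.

Lemma D2E f g y : bmeas Om f -> bmeas Om' g -> Om' y ->
  D2 f g y = eps^-1 * \int[P]_(x in Om) (slack c fs gs (x, y) - slack c f g (x, y)).
Proof.
move=> bf bg Oy; have bs := bmeas_slack mOm mOm' bc bf bg.
rewrite (bRintegralB P mOm (bmeas_sectionr mOm mOm' Oy bss) (bmeas_sectionr mOm mOm' Oy bs)).
by rewrite slack2// mulrBr mulVf ?lt0r_neq0.
Qed.

Variable eta : R.
Hypotheses (eta0 : 0 < eta) (eta_eps : eta <= eps).

Let avg_le (k s : R) : 0 <= k -> s <= k -> eta * (eps^-1 * s) <= k.
Proof.
move=> k0 sk; rewrite mulrA; apply: (le_trans (ler_wpM2l _ sk)).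
  by rewrite divr_ge0// ltW.
by rewrite ler_piMl// ler_pdivrMr// mul1r.
Qed.

Let avg_ge (k s : R) : 0 <= k -> - k <= s -> - k <= eta * (eps^-1 * s).
Proof.
move=> k0 sk; have := avg_le k0 (_ : - s <= k); rewrite !mulrN.
by rewrite lerNl => /(_ sk); rewrite lerNl.
Qed.

(** An ascent step keeps f - fs and gs - g in any interval containing the values
    of both: the new value is at most, and at least, a convex combination of the
    old value with an end of the interval. *)
Lemma step1_bounds f g m M : bmeas Om f -> bmeas Om' g ->
  (forall x, Om x -> m <= f x - fs x <= M) ->
  (forall y, Om' y -> m <= gs y - g y <= M) ->
  forall x, Om x -> m <= f x + eta * D1 f g x - fs x <= M.
Proof.
move=> bf bg fb gb x Ox; rewrite D1E//.
have bs := bmeas_slack mOm mOm' bc bf bg.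
have bx := bmeasB (bmeas_sectionl mOm mOm' Ox bss) (bmeas_sectionl mOm mOm' Ox bs).
have /andP[fm fM] := fb x Ox.
have ub : \int[Q]_(y in Om') (slack c fs gs (x, y) - slack c f g (x, y)) <= M - (f x - fs x).
  apply: Rintegral_ub => // y Oy; rewrite lerBlDl.
  apply: max0_shift; first by rewrite subr_ge0.
  by have := gb y Oy; rewrite /oplus/=; lra.
have lb : - ((f x - fs x) - m) <= \int[Q]_(y in Om') (slack c fs gs (x, y) - slack c f g (x, y)).
  apply: Rintegral_lb => // y Oy; rewrite lerNl opprB lerBlDl.
  apply: max0_shift; first by rewrite subr_ge0.
  by have := gb y Oy; rewrite /oplus/=; lra.
have := avg_le (_ : 0 <= M - (f x - fs x)) ub; have := avg_ge (_ : 0 <= f x - fs x - m) lb.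
by rewrite !subr_ge0 => /(_ fm) + /(_ fM); lra.
Qed.

Lemma step2_bounds f g m M : bmeas Om f -> bmeas Om' g ->
  (forall x, Om x -> m <= f x - fs x <= M) ->
  (forall y, Om' y -> m <= gs y - g y <= M) ->
  forall y, Om' y -> m <= gs y - (g y + eta * D2 f g y) <= M.
Proof.
move=> bf bg fb gb y Oy; rewrite D2E//.
have bs := bmeas_slack mOm mOm' bc bf bg.
have bx := bmeasB (bmeas_sectionr mOm mOm' Oy bss) (bmeas_sectionr mOm mOm' Oy bs).
have /andP[gm gM] := gb y Oy.
have ub : \int[P]_(x in Om) (slack c fs gs (x, y) - slack c f g (x, y)) <= (gs y - g y) - m.
  apply: Rintegral_ub => // x Ox; rewrite lerBlDl.
  apply: max0_shift; first by rewrite subr_ge0.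
  by have := fb x Ox; rewrite /oplus/=; lra.
have lb : - (M - (gs y - g y)) <= \int[P]_(x in Om) (slack c fs gs (x, y) - slack c f g (x, y)).
  apply: Rintegral_lb => // x Ox; rewrite lerNl opprB lerBlDl.
  apply: max0_shift; first by rewrite subr_ge0.
  by have := fb x Ox; rewrite /oplus/=; lra.
have := avg_le (_ : 0 <= gs y - g y - m) ub; have := avg_ge (_ : 0 <= M - (gs y - g y)) lb.
by rewrite !subr_ge0 => /(_ gM) + /(_ gm); lra.
Qed.

End optimal_potentials.

(** * Gradient domination *)

Lemma pl_arith (R : realFieldType) (k s v g : R) :
  0 < k -> g <= k / 2 * s + (2 * k)^-1 * v -> v <= k * g ->
  g <= k * s /\ v <= k ^+ 2 * s.
Proof.
move=> k0 gs vg.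
have : (2 * k)^-1 * v <= g / 2.
  rewrite mulrC ler_pdivrMr ?mulr_gt0// (_ : g / 2 * _ = k * g)//.
  by field.
move=> h; have gks : g <= k * s by lra.
by split=> //; rewrite (le_trans vg)// expr2 -mulrA ler_wpM2l// ltW.
Qed.

Section gradient_domination.
Context (R : realType) (d : nat).
Local Notation Rd := ('rV[R]_d).
Variables (P Q : probability Rd R) (c : Rd -> Rd -> R) (eps : R).
Local Notation Om := (supp P).
Local Notation Om' := (supp Q).
Hypotheses (eps0 : 0 < eps) (cP : compact Om) (cQ : compact Om').
Variable L : R.
Hypotheses (L0 : 0 < L) (hc : elipschitz2 L c).
Implicit Types f g : Rd -> R.

Local Notation Gam := (Gamma P Q c eps).
Local Notation D1 := (D1Gamma Q c eps).
Local Notation D2 := (D2Gamma P c eps).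
Local Notation PQ := (P \x Q)%E.
Local Notation D := (Om `*` Om').

Let mOm : measurable Om. Proof. exact: compact_measurable_rV. Qed.
Let mOm' : measurable Om'. Proof. exact: compact_measurable_rV. Qed.
Let PE : P Om = 1%E. Proof. exact: probability_supp. Qed.
Let QE : Q Om' = 1%E. Proof. exact: probability_supp. Qed.
Let mD : measurable D. Proof. exact: measurableX. Qed.
Let bc : bmeas D (fun z => c z.1 z.2). Proof. exact: (bmeas_cost L0 hc). Qed.

Variables fs gs : Rd -> R.
Hypotheses (bfs : bmeas Om fs) (bgs : bmeas Om' gs).
Hypotheses (lfs : elipschitz_on Om L fs) (lgs : elipschitz_on Om' L gs).
Hypothesis foc1 : forall x, Om x -> D1 fs gs x = 0.
Hypothesis foc2 : forall y, Om' y -> D2 fs gs y = 0.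

Let bss := bmeas_slack mOm mOm' bc bfs bgs.

Let slack_lt x y : fs x + gs y - c x y < 99 / 100 * eps ->
  slack c fs gs (x, y) <= 99 / 100 * eps.
Proof.
by move=> h; rewrite /slack /oplus /= ge_max (ltW h)/= mulr_ge0// ltW.
Qed.

(** Every point of one support is in contact with a point of the other: the
    positive part of fs + gs - c has mean eps, so fs + gs - c nearly reaches eps. *)
Lemma contact1 x : Om x ->
  exists2 y, Om' y & 99 / 100 * eps <= fs x + gs y - c x y.
Proof.
move=> Ox; apply: contrapT => ny; have /eqP := foc1 Ox.
apply/negP; rewrite subr_eq0 eq_sym lt_eqF// mulrC ltr_pdivrMr// mul1r.
apply: (@le_lt_trans _ _ (99 / 100 * eps)); last by move: eps0; lra.
apply: (Rintegral_ub mOm' QE (bmeas_sectionl mOm mOm' Ox bss)) => y Oy.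
apply: slack_lt; rewrite ltNge; apply/negP => h; apply: ny.
by exists y.
Qed.

Lemma contact2 y : Om' y ->
  exists2 x, Om x & 99 / 100 * eps <= fs x + gs y - c x y.
Proof.
move=> Oy; apply: contrapT => ny; have /eqP := foc2 Oy.
apply/negP; rewrite subr_eq0 eq_sym lt_eqF// mulrC ltr_pdivrMr// mul1r.
apply: (@le_lt_trans _ _ (99 / 100 * eps)); last by move: eps0; lra.
apply: (Rintegral_ub mOm PE (bmeas_sectionr mOm mOm' Oy bss)) => x Ox.
apply: slack_lt; rewrite ltNge; apply/negP => h; apply: ny.
by exists x.
Qed.

Let r := eps / (8 * L).
Let r0 : 0 < r. Proof. by rewrite divr_gt0// mulr_gt0. Qed.

(** By the Lipschitz bounds, fs + gs - c is still at least 9/16 eps when both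
    points move by at most eps / (8 L): the loss from 99/100 eps is at most
    (1/8 + 1/8 + 283/1600) eps. *)
Lemma contact_near x y x' y' : Om x -> Om' y -> Om x' -> Om' y' ->
  99 / 100 * eps <= fs x + gs y - c x y ->
  enorm (x' - x) <= r -> enorm (y' - y) <= r ->
  9 / 16 * eps <= fs x' + gs y' - c x' y'.
Proof.
move=> Ox Oy Ox' Oy' u xx yy.
have Lr : L * r = eps / 8 by rewrite /r; field; exact: lt0r_neq0.
have := lfs Ox' Ox; rewrite ler_norml => /andP[h1 _].
have := lgs Oy' Oy; rewrite ler_norml => /andP[h2 _].
have := hc x' y' x y; rewrite ler_norml => /andP[_ h3].
have k1 : L * enorm (x' - x) <= L * r by rewrite ler_wpM2l// ltW.
have k2 : L * enorm (y' - y) <= L * r by rewrite ler_wpM2l// ltW.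
have k3 : L * Num.sqrt (enorm (x' - x) ^+ 2 + enorm (y' - y) ^+ 2) <= 283 / 200 * (L * r).
  rewrite mulrCA ler_wpM2l ?(ltW L0)//; apply: sqrt_sqrD_le; first exact: ltW.
  - by rewrite enorm_ge0.
  - by rewrite enorm_ge0.
by rewrite Lr in k1 k2 k3; move: eps0; lra.
Qed.

Section errors.
Variables f g : Rd -> R.
Hypotheses (bf : bmeas Om f) (bg : bmeas Om' g).
Let a := f \- fs.
Let b := g \- gs.
Let ba : bmeas Om a. Proof. exact: bmeasB. Qed.
Let bb : bmeas Om' b. Proof. exact: bmeasB. Qed.
Let bs := bmeas_slack mOm mOm' bc bf bg.
Let bh : bmeas D (oplus a b). Proof. exact: bmeas_oplus. Qed.

(* Minus the derivative of the dual objective in the direction of the error. *)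
Let dG := - dGamma P Q c eps f g a b.

Lemma gap_le_slope : Gam fs gs - Gam f g <= dG.
Proof.
have := Gamma_le_linear eps0 mOm mOm' bc bf bg (bmeasN ba) (bmeasN bb).
rewrite (@eq_Gamma _ _ _ _ _ _ (f \+ _) (g \+ _) fs gs); first last.
- by move=> y _; rewrite /b/=; ring.
- by move=> x _; rewrite /a/=; ring.
rewrite /dG {1}/dGamma.
rewrite (@eq_bRintegral _ _ _ P _ _ (fun x => - (D1 f g x * a x))); last by move=> x _; ring.
rewrite (@eq_bRintegral _ _ _ Q _ _ (fun y => - (D2 f g y * b y))); last by move=> x _; ring.
have b1 := bmeasM (bmeas_D1 eps mOm mOm' bc bf bg) ba.
have b2 := bmeasM (bmeas_D2 eps mOm mOm' bc bf bg) bb.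
rewrite (bRintegralN P mOm b1) (bRintegralN Q mOm' b2) /dGamma; lra.
Qed.

Lemma slopeE : dG =
  eps^-1 * \int[PQ]_(z in D) ((slack c f g z - slack c fs gs z) * oplus a b z).
Proof.
have z0 : dGamma P Q c eps fs gs a b = 0.
  rewrite /dGamma.
  rewrite (@eq_bRintegral _ _ _ P _ _ (fun=> 0)); last by move=> x Ox; rewrite foc1// mul0r.
  rewrite (@eq_bRintegral _ _ _ Q _ _ (fun=> 0)); last by move=> x Ox; rewrite foc2// mul0r.
  by rewrite !Rintegral_cst// !mul0r addr0.
rewrite -[LHS]add0r -z0 /dG.
rewrite (dGammaE eps mOm mOm' bc bf bg ba bb) (dGammaE eps mOm mOm' bc bfs bgs ba bb).
have bw s : bmeas D s -> bmeas D (fun z => (1 - eps^-1 * s z) * oplus a b z).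
  by move=> bs'; apply: bmeasM => //; apply: bmeasB; [exact: bmeas_cst|exact: bmeasZ].
have bd := bmeasM (bmeasB bs bss) bh.
rewrite -(bRintegralB PQ mD (bw _ bss) (bw _ bs)) -(bRintegralZ PQ mD _ bd).
by apply: eq_bRintegral => z _; ring.
Qed.

(** Quadratic growth of the slope dG implies that dG, hence the suboptimality
    gap, is bounded by the squared norm of the gradient. *)
Lemma polyak (k : R) : 0 < k ->
  \int[PQ]_(z in D) (oplus a b z ^+ 2) <= k * dG ->
  dG <= k * (sqr_D1 P Q c eps f g + sqr_D2 P Q c eps f g) /\
  \int[PQ]_(z in D) (oplus a b z ^+ 2) <=
    k ^+ 2 * (sqr_D1 P Q c eps f g + sqr_D2 P Q c eps f g).
Proof.
move=> k0; apply: pl_arith => //.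
(* Shifting to (a + s, b - s), with b - s of mean zero, changes neither a + b nor
   the slope, and makes the two components orthogonal in L^2. *)
pose s := \int[Q]_(y in Om') b y.
pose a' x := a x + s; pose b' y := b y - s.
have ba' : bmeas Om a' by apply: bmeasD => //; exact: bmeas_cst.
have bb' : bmeas Om' b' by apply: bmeasB => //; exact: bmeas_cst.
have abE z : oplus a b z = oplus a' b' z by rewrite /oplus /a' /b'; ring.
have b'0 : \int[Q]_(y in Om') b' y = 0.
  by rewrite (bRintegralB Q mOm' bb (bmeas_cst Om' s)) (Rintegral_cst1 mOm' QE) subrr.
have ba2 := bmeasX 2 ba'; have bb2 := bmeasX 2 bb'.
have hE : \int[PQ]_(z in D) (oplus a b z ^+ 2) =
    \int[P]_(x in Om) (a' x ^+ 2) + \int[Q]_(y in Om') (b' y ^+ 2).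
  have b1 := bmeas_fst mOm mOm' ba2; have b2 := bmeas_snd mOm mOm' bb2.
  have b3 : bmeas D (fun z => a' z.1 * b' z.2).
    by apply: bmeasM; [exact: bmeas_fst|exact: bmeas_snd].
  rewrite (@eq_bRintegral _ _ _ PQ _ _ (fun z => (a' z.1 ^+ 2 + b' z.2 ^+ 2) + 2 * (a' z.1 * b' z.2))); last first.
    by move=> z _; rewrite abE /oplus; ring.
  rewrite (bRintegralD PQ mD (bmeasD b1 b2) (bmeasZ 2 b3)) (bRintegralD PQ mD b1 b2).
  rewrite (bRintegralZ PQ mD 2 b3) (bRintegral_prodl P Q mOm mOm' b3).2.
  rewrite (@eq_bRintegral _ _ _ P _ (fun x => \int[Q]_(y in Om') _) (fun=> 0)); last first.
    by move=> x _ /=; rewrite (bRintegralZ Q mOm' _ bb') b'0 mulr0.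
  rewrite Rintegral_cst// mul0r mulr0 addr0.
  by rewrite (bRintegral_fst P mOm mOm' QE ba2) (bRintegral_snd Q mOm mOm' PE bb2).
have dGE : dG = - dGamma P Q c eps f g a' b'.
  rewrite /dG (dGammaE eps mOm mOm' bc bf bg ba bb) (dGammaE eps mOm mOm' bc bf bg ba' bb').
  by congr (- _); apply: eq_bRintegral => z _; rewrite abE.
have young (u v : R) : - (u * v) <= k / 2 * u ^+ 2 + (2 * k)^-1 * v ^+ 2.
  have : 0 <= (2 * k)^-1 * (k * u + v) ^+ 2.
    by rewrite mulr_ge0 ?sqr_ge0// invr_ge0 mulr_ge0// ltW.
  have -> : (2 * k)^-1 * (k * u + v) ^+ 2 = k / 2 * u ^+ 2 + (2 * k)^-1 * v ^+ 2 + u * v.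
    by field; exact: lt0r_neq0.
  by move=> h; lra.
have bD1 := bmeas_D1 eps mOm mOm' bc bf bg; have bD2 := bmeas_D2 eps mOm mOm' bc bf bg.
have y1 : - (\int[P]_(x in Om) (D1 f g x * a' x)) <=
    k / 2 * sqr_D1 P Q c eps f g + (2 * k)^-1 * \int[P]_(x in Om) (a' x ^+ 2).
  have bD12 := bmeasX 2 bD1; have bm := bmeasM bD1 ba'.
  have bR := bmeasD (bmeasZ (k / 2) bD12) (bmeasZ (2 * k)^-1 ba2).
  have := ler_bRintegral P mOm (bmeasN bm) bR (fun x _ => young _ _).
  rewrite (bRintegralN P mOm bm) (bRintegralD P mOm (bmeasZ (k / 2) bD12) (bmeasZ (2 * k)^-1 ba2)).
  by rewrite (bRintegralZ P mOm _ bD12) (bRintegralZ P mOm _ ba2).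
have y2 : - (\int[Q]_(x in Om') (D2 f g x * b' x)) <=
    k / 2 * sqr_D2 P Q c eps f g + (2 * k)^-1 * \int[Q]_(x in Om') (b' x ^+ 2).
  have bD22 := bmeasX 2 bD2; have bm := bmeasM bD2 bb'.
  have bR := bmeasD (bmeasZ (k / 2) bD22) (bmeasZ (2 * k)^-1 bb2).
  have := ler_bRintegral Q mOm' (bmeasN bm) bR (fun x _ => young _ _).
  rewrite (bRintegralN Q mOm' bm) (bRintegralD Q mOm' (bmeasZ (k / 2) bD22) (bmeasZ (2 * k)^-1 bb2)).
  by rewrite (bRintegralZ Q mOm' _ bD22) (bRintegralZ Q mOm' _ bb2).
by rewrite hE dGE /dGamma; lra.
Qed.

Variables (rho : Rd -> R) (lambdaP LambdaP mP mQ M : R) (N : nat).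
Hypotheses (cvP : convex_set Om) (hrho : is_density P rho) (lambda0 : 0 < lambdaP).
Hypothesis rho_bounds : forall x, Om x -> lambdaP <= rho x <= LambdaP.
Hypotheses (mQ0 : 0 < mQ) (mQ1 : mQ <= 1) (N0 : (0 < N)%N).
Hypothesis mQP : forall y, Om' y -> (mQ%:E <= Q (eball y r))%E.
Hypothesis mPP : forall x, Om x -> (mP%:E <= P (eball x r))%E.
Hypothesis diamN : forall x x', Om x -> Om x' -> enorm (x - x') <= N%:R * r.
Hypotheses (epsM : eps <= M) (hM : forall z, D z -> `|oplus a b z| <= M).

(** Quadratic growth: the slope controls the squared error. The slope is the
    integral of a nonnegative function which, near the contact pairs, is bounded
    below by a multiple of the squared error; the Poincare inequality does the
    rest. *)
Lemma quadratic_growth : mP * \int[PQ]_(z in D) (oplus a b z ^+ 2) <=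
  16 * (N%:R ^+ (d + 2) * (LambdaP / lambdaP) / mQ) * M * dG.
Proof.
have M0 : 0 < M by exact: lt_le_trans epsM.
(* k is such that Phi >= h^2 where fs + gs - c >= 9/16 eps. *)
pose k := 16 / 9 * M / eps.
have k0 : 0 <= k by rewrite /k !mulr_ge0// ?invr_ge0 ltW.
pose Phi z := k * ((slack c f g z - slack c fs gs z) * oplus a b z).
have bd := bmeasM (bmeasB bs bss) bh.
have bPhi : bmeas D Phi by exact: bmeasZ.
have hE z : oplus a b z = (oplus f g z - c z.1 z.2) - (oplus fs gs z - c z.1 z.2).
  by rewrite /oplus /a /b /=; ring.
have Phi0 z : D z -> 0 <= Phi z.
  by move=> _; rewrite /Phi mulr_ge0// hE; exact: max0_monotone_ge0.
have PhiP x y : Om x -> Om' y -> 9 / 16 * eps <= fs x + gs y - c x y ->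
    (a x + b y) ^+ 2 <= Phi (x, y).
  move=> Ox Oy u; have e0 : 0 < 9 / 16 * eps by rewrite mulr_gt0.
  rewrite -(ler_pM2l e0) -/(oplus a b (x, y)).
  rewrite (_ : _ * Phi _ = M * ((slack c f g (x, y) - slack c fs gs (x, y)) * oplus a b (x, y))); last first.
    by rewrite /Phi /k; field; exact: lt0r_neq0.
  have hMz := hM (conj Ox Oy : D (x, y)); rewrite hE in hMz *.
  apply: max0_monotone_lb => //; [exact: ltW|].
  by apply: le_trans epsM; rewrite ler_piMl// ?(ltW eps0)//; lra.
have := @poincare _ _ _ _ cP cQ cvP _ _ _ hrho lambda0 rho_bounds r mP mQ N
  r0 mQ0 mQ1 N0 mQP mPP diamN a b Phi ba bb bPhi Phi0.
rewrite (_ : \int[PQ]_(z in D) Phi z = 16 / 9 * M * dG); last first.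
  by rewrite slopeE (bRintegralZ PQ mD _ bd) /k; ring.
rewrite (_ : 9 * _ * _ = 16 * (N%:R ^+ (d + 2) * (LambdaP / lambdaP) / mQ) * M * dG); last by field; rewrite !lt0r_neq0.
apply.
- move=> x Ox; have [y Oy u] := contact1 Ox; exists y => // x' y' Ox' Oy' xx yy.
  by apply: PhiP => //; apply: (contact_near Ox Oy Ox' Oy' u xx); exact: ltW.
- move=> y Oy; have [x Ox u] := contact2 Oy; exists x => // x' Ox' xx.
  apply: PhiP => //; apply: (contact_near Ox Oy Ox' Oy u (ltW xx)).
  by rewrite subrr enorm0 ltW.
Qed.

End errors.
End gradient_domination.

(** * Linear convergence *)

(** If a - b is bounded by H then a and b take values in a common interval of
    length 2 H. *)
Lemma common_interval (R : realType) (T U : Type) (A : set T) (B : set U)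
    (a : T -> R) (b : U -> R) (H : R) : A !=set0 -> B !=set0 ->
  (forall x y, A x -> B y -> `|a x - b y| <= H) ->
  exists m, (forall x, A x -> m <= a x <= m + 2 * H) /\
            (forall y, B y -> m <= b y <= m + 2 * H).
Proof.
move=> [x0 Ax0] [y0 By0] abH.
have ab x y : A x -> B y -> a x - b y <= H /\ b y - a x <= H.
  by move=> Ax By; have := abH x y Ax By; rewrite ler_norml => /andP[? ?]; split; lra.
pose S := (a @` A) `|` (b @` B).
have diff v w : S v -> S w -> v - 2 * H <= w.
  move=> [[x Ax <-]|[y By <-]] [[x' Ax' <-]|[y' By' <-]].
  - by have [? ?] := ab _ _ Ax By0; have [? ?] := ab _ _ Ax' By0; lra.
  - have [? ?] := ab _ _ Ax By'; have := abH _ _ Ax By'.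
    by have := normr_ge0 (a x - b y'); lra.
  - have [? ?] := ab _ _ Ax' By; have := abH _ _ Ax' By.
    by have := normr_ge0 (a x' - b y); lra.
  - by have [? ?] := ab _ _ Ax0 By; have [? ?] := ab _ _ Ax0 By'; lra.
have S0 : S !=set0 by exists (a x0); left; exists x0.
have Sinf v : S v -> inf S <= v <= inf S + 2 * H.
  move=> Sv; apply/andP; split.
    by apply: ge_inf => //; exists (v - 2 * H) => w Sw; exact: diff.
  by rewrite -lerBlDr; apply: lb_le_inf => // w Sw; exact: diff.
exists (inf S); split=> [x Ax|y By]; apply: Sinf; [by left; exists x|by right; exists y].
Qed.

Lemma supnorm_fin (R : realType) (T : Type) (A : set T) (h : T -> R) (M : R) :
  A !=set0 -> (forall x, A x -> `|h x| <= M) ->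
  exists2 s : R, supnorm A h = s%:E & forall x, A x -> `|h x| <= s.
Proof.
move=> [x0 Ax0] hM.
have ub x : A x -> (`|h x|%:E <= supnorm A h)%E.
  by move=> Ax; apply: ereal_sup_ubound; exists x.
have : (supnorm A h <= M%:E)%E.
  by apply: ge_ereal_sup => _ [x Ax <-]; rewrite lee_fin hM.
move: ub; case: (supnorm A h) => [s| |] ub //.
- by move=> _; exists s => // x /ub; rewrite lee_fin.
- by move: (ub _ Ax0).
Qed.

Lemma supnorm_le (R : realType) (T : Type) (A : set T) (h : T -> R) (s : R) :
  (forall x, A x -> `|h x| <= s) -> (supnorm A h <= s%:E)%E.
Proof. by move=> hs; apply: ge_ereal_sup => _ [x Ax <-]; rewrite lee_fin hs. Qed.

Lemma max_expV (R : realFieldType) (t : R) n : 0 < t ->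
  Num.max t 1 ^+ n = (Num.min (t^-1 ^+ n) 1)^-1.
Proof.
move=> t0; have [t1|t1] := leP t 1.
  rewrite expr1n min_r ?invr1// exprn_ege1//.
  by rewrite invf_ge1.
rewrite min_l ?exprVn ?invrK// invf_le1 ?exprn_gt0// exprn_ege1// ltW//.
Qed.

Theorem corollary2p8 (R : realType) (d : nat) (hd : (0 < d)%N)
  (eps : R) (heps : 0 < eps)
  (P Q : probability 'rV[R]_d R)
  (hPconvex : convex_set (supp P)) (hPcompact : compact (supp P))
  (hQcompact : compact (supp Q))
  (rho : 'rV[R]_d -> R) (hrho : is_density P rho)
  (lambdaP LambdaP : R) (hlambda : 0 < lambdaP) (hLambda : lambdaP < LambdaP)
  (hrho_bounds : forall x, supp P x -> lambdaP <= rho x <= LambdaP)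
  (L : R) (hL : 0 < L)
  (c : 'rV[R]_d -> 'rV[R]_d -> R) (hc : elipschitz2 L c)
  (deltaP : R) (hdelta : 0 < deltaP <= 1)
  (hdeltaP : forall (r : R) x, 0 < r -> supp P x ->
    ((deltaP * Num.min (r ^+ d) 1)%:E <= P (eball x r))%E)
  (fs gs : 'rV[R]_d -> R) (hmax : is_maximizer P Q c eps fs gs)
  (hfs : elipschitz_on (supp P) L fs) (hgs : elipschitz_on (supp Q) L gs)
  (f g : nat -> 'rV[R]_d -> R)
  (hf0 : Linfty_supp P (f 0%N)) (hg0 : Linfty_supp Q (g 0%N))
  (eta : R) (heta0 : 0 < eta) (heta : eta < eps / Num.sqrt 2)
  (hfg : gradient_ascent P Q c eps eta f g) :
  let Om := supp P in
  let Om' := supp Q in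
  let gamma := gamma_eps P Q eps L deltaP lambdaP LambdaP in
  let M := Num.max
    (2 * fine (supnorm (Om `*` Om') (oplus (f 0%N) (g 0%N) \- oplus fs gs))) eps in
  let q := eta * (1 - eta / (2 * eps)) / (2 * gamma * M) in
  let Delta := fun n => (QOT P Q c eps - (Gamma P Q c eps (f n) (g n))%:E)%E in
  forall n : nat,
  [/\ (Order.max (supnorm Om (f n.+1 \- fs)%R) (supnorm Om' (g n.+1 \- gs)%R)
       <= Order.max (supnorm Om (f n \- fs)%R) (supnorm Om' (g n \- gs)%R))%E,
      (Delta n <= ((1 - q) ^+ n)%:E * Delta 0%N)%E &
      ('N[(P \x Q)%E]_2%:E[EFin \o
          ((oplus (f n) (g n) \- oplus fs gs)%R \_ (Om `*` Om'))] ^+ 2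
       <= (2 * gamma ^+ 2 * M ^+ 2 / (eta * (1 - eta / (2 * eps))))%:E
          * Delta 0%N * ((1 - q) ^+ n)%:E)%E].
Proof.
move=> Om Om' gamma M q Delta.
have mOm : measurable Om by exact: compact_measurable_rV.
have mOm' : measurable Om' by exact: compact_measurable_rV.
have Om0 : Om !=set0 by exact: supp_neq0.
have Om'0 : Om' !=set0 by exact: supp_neq0.
have mD : measurable (Om `*` Om') by exact: measurableX.
have mc := measurable_cost hL hc.
have bc : bmeas (Om `*` Om') (fun z => c z.1 z.2) by exact: (bmeas_cost hL hc).
have [L2f L2g Gmax'] := hmax.
have bfs : bmeas Om fs by apply: (bmeas_lipschitz hL) => //; exact: measurable_L2_supp.
have bgs : bmeas Om' gs by apply: (bmeas_lipschitz hL) => //; exact: measurable_L2_supp.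
have Gmax f' g' : bmeas Om f' -> bmeas Om' g' ->
    Gamma P Q c eps f' g' <= Gamma P Q c eps fs gs.
  by move=> bf' bg'; apply: Gmax'; exact: bmeas_L2_supp.
have foc1 x : Om x -> D1Gamma Q c eps fs gs x = 0.
  exact: (first_order1 heps hPcompact hQcompact hL hc bfs bgs hfs Gmax).
have foc2 y : Om' y -> D2Gamma P c eps fs gs y = 0.
  exact: (first_order2 heps hPcompact hQcompact hL hc bfs bgs hgs Gmax).
have QOTE := QOT_dual heps mOm mOm' mc bc bfs bgs foc1 foc2.
pose r := eps / (8 * L); have r0 : 0 < r by rewrite divr_gt0// mulr_gt0.
have /andP[delta0 delta1] := hdelta.
pose mP := deltaP * Num.min (r ^+ d) 1.
have mP0 : 0 < mP by rewrite mulr_gt0// lt_min exprn_gt0//=.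
have mP1 : mP <= 1 by rewrite mulr_ile1// ?(ltW delta0) ?le_min ?ge_min ?lexx ?orbT ?exprn_ge0 ?(ltW r0)//=.
have mPP x : Om x -> (mP%:E <= P (eball x r))%E by move=> Ox; exact: hdeltaP.
have [mQ mQ0 mQE] := inf_eball_gt0 hQcompact r0.
have mQP y : Om' y -> (mQ%:E <= Q (eball y r))%E.
  by move=> Oy; rewrite -mQE; apply: ereal_inf_lbound; exists y.
have mQ1 : mQ <= 1.
  have [y Oy] := Om'0; rewrite -lee_fin (le_trans (mQP _ Oy))// probability_le1//.
  exact: measurable_eball.
pose X := 8 * L * ediam Om / eps.
have X0 : 0 < X.
  by rewrite divr_gt0// mulr_gt0// ?mulr_gt0//; exact: (ediam_supp_gt0 hrho).
(* X > 0 because the support of P is not a point, so that N >= 1. *)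
pose N := `|Num.ceil X|%N.
have NE : (Num.ceil X)%:~R = N%:R :> R.
  by rewrite /N natr_absz ger0_norm// ceil_ge0// (lt_le_trans _ (ltW X0))// ltrN10.
have XN : X <= N%:R by rewrite -NE; exact: ceil_ge.
have N0 : (0 < N)%N by rewrite -(ltr_nat R); exact: lt_le_trans XN.
have diamN x x' : Om x -> Om x' -> enorm (x - x') <= N%:R * r.
  move=> Ox Ox'; apply: (le_trans (enorm_le_ediam hPcompact Ox Ox')).
  by rewrite mulrA ler_pdivlMr ?mulr_gt0// -ler_pdivrMr// [ediam _ * _]mulrC.
have gammaE : gamma = 16 * mP^-1 * (LambdaP ^+ 2 / lambdaP ^+ 2) * (N%:R ^+ (d + 2) / mQ).
  rewrite /gamma /gamma_eps -/X NE mQE /= max_expV ?divr_gt0// ?mulr_gt0//.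
  by rewrite invf_div -/r -invfM.
have LL1 : 1 <= LambdaP / lambdaP by rewrite ler_pdivlMr// mul1r ltW.
have LL2 : LambdaP / lambdaP <= LambdaP ^+ 2 / lambdaP ^+ 2.
  by rewrite -expr_div_n expr2 ler_peMl// (le_trans ler01).
have NN1 : 1 <= N%:R ^+ (d + 2) :> R by rewrite exprn_ege1// ler1n.
have gamma1 : 1 <= gamma.
  have mP1' : 1 <= mP^-1 by rewrite invf_ge1.
  have LL3 : 1 <= LambdaP ^+ 2 / lambdaP ^+ 2 by exact: le_trans LL2.
  have NQ1 : 1 <= N%:R ^+ (d + 2) / mQ :> R.
    by rewrite ler_pdivlMr// mul1r (le_trans mQ1).
  rewrite gammaE; do 3 apply: mulr_ege1 => //; lra.
have gamma0 : 0 < gamma by exact: lt_le_trans gamma1.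
have epsM : eps <= M by rewrite le_max lexx orbT.
have M0 : 0 < M by exact: lt_le_trans epsM.
pose kap := gamma * M; have kap0 : 0 < kap by rewrite mulr_gt0.
have sqrt2 : 0 < Num.sqrt (2 : R) by rewrite sqrtr_gt0.
have eta2 : 2 * eta ^+ 2 <= eps ^+ 2.
  have es : eta * Num.sqrt 2 <= eps by rewrite -ler_pdivlMr// ltW.
  have -> : 2 * eta ^+ 2 = (eta * Num.sqrt 2) ^+ 2 by rewrite exprMn sqr_sqrtr// mulrC.
  by rewrite lerXn2r// nnegrE ?(ltW heps)// mulr_ge0// ltW.
have eta_eps : eta <= eps.
  rewrite -(ler_pXn2r (ltn0Sn 1)) ?nnegrE ?(ltW heta0) ?(ltW heps)//.
  by apply: le_trans eta2; rewrite ler_peMl ?sqr_ge0//; lra.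
pose A := eta * (1 - eta / (2 * eps)).
have A0 : 0 < A.
  rewrite mulr_gt0// subr_gt0 ltr_pdivrMr ?mulr_gt0// mul1r.
  by move: heps eta_eps; lra.
have qE : q = A / (2 * kap) by rewrite /q /kap mulrA.
have q1 : q <= 1.
  rewrite qE ler_pdivrMr; last by rewrite mulr_gt0.
  have : A <= eta by rewrite ler_piMr ?(ltW heta0)// gerBl divr_ge0// ltW// mulr_gt0.
  have : M <= kap by rewrite ler_peMl// ltW.
  by move: eta_eps epsM M0; rewrite mul1r; lra.
have step1 := step1_bounds heps hPcompact hQcompact hL hc bfs bgs hfs Gmax heta0 eta_eps.
have step2 := step2_bounds heps hPcompact hQcompact hL hc bfs bgs hgs Gmax heta0 eta_eps.
have b0 : bmeas Om (f 0%N) /\ bmeas Om' (g 0%N) by split; exact: bmeas_Linfty_supp.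
have bh0 : bmeas (Om `*` Om') (oplus (f 0%N) (g 0%N) \- oplus fs gs).
  apply: bmeasB; first exact: (bmeas_oplus mOm mOm' b0.1 b0.2).
  exact: (bmeas_oplus mOm mOm' bfs bgs).
have D0 : (Om `*` Om') !=set0.
  by have [x Ox] := Om0; have [y Oy] := Om'0; exists (x, y).
have [_ [B0 B0P]] := bh0.
have [H0 H0E H0P] := supnorm_fin D0 B0P.
have HM : 2 * H0 <= M by rewrite /M H0E le_max lexx.
(* f_n - fs and gs - g_n stay in a fixed interval of length 2 H0, so the error
   f_n + g_n - fs - gs stays below 2 H0, although it may exceed H0. *)
have [|m [m1 m2]] := @common_interval _ _ _ Om Om' (f 0%N \- fs) (gs \- g 0%N) H0 Om0 Om'0.
  move=> x y Ox Oy; have := H0P (x, y) (conj Ox Oy).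
  rewrite /oplus/=; congr (`|_| <= _); ring.
have iter n : [/\ bmeas Om (f n), bmeas Om' (g n),
    forall x, Om x -> m <= f n x - fs x <= m + 2 * H0 &
    forall y, Om' y -> m <= gs y - g n y <= m + 2 * H0].
  elim: n => [|n [bfn bgn i1 i2]]; first by split=> //; [exact: b0.1|exact: b0.2].
  have [h1 h2] := hfg n.
  have bf' : bmeas Om (f n.+1).
    apply: eq_bmeas (bmeasD bfn (bmeasZ eta (bmeas_D1 eps mOm mOm' bc bfn bgn))) => x Ox.
    by rewrite h1.
  have bg' : bmeas Om' (g n.+1).
    apply: eq_bmeas (bmeasD bgn (bmeasZ eta (bmeas_D2 eps mOm mOm' bc bf' bgn))) => y Oy.
    by rewrite h2.
  have i1' x : Om x -> m <= f n.+1 x - fs x <= m + 2 * H0.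
    by move=> Ox; rewrite h1//; exact: step1 bfn bgn i1 i2 x Ox.
  split=> // y Oy; rewrite h2//.
  exact: step2 bf' bgn i1' i2 y Oy.
have bf n : bmeas Om (f n) by case: (iter n).
have bg n : bmeas Om' (g n) by case: (iter n).
have hM n z : (Om `*` Om') z -> `|oplus (f n \- fs) (g n \- gs) z| <= M.
  case: z => x y [/= Ox Oy]; have [_ _ i1 i2] := iter n.
  have /andP[? ?] := i1 x Ox; have /andP[? ?] := i2 y Oy.
  by apply: le_trans HM; rewrite /oplus/= ler_norml; apply/andP; split; lra.
pose gap n := Gamma P Q c eps fs gs - Gamma P Q c eps (f n) (g n).
have DeltaE n : Delta n = (gap n)%:E by rewrite /Delta QOTE.
have gap0 n : 0 <= gap n by rewrite subr_ge0; exact: Gmax.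
pose S n := sqr_D1 P Q c eps (f n) (g n) + sqr_D2 P Q c eps (f n) (g n).
have descent n : gap n.+1 <= gap n - A / 2 * S n.
  have [h1 h2] := hfg n.
  have := Gamma_sweep heps mOm mOm' bc (bf n) (bg n) heta0 eta2 h1 h2.
  by rewrite /gap /S /A; lra.
have pl n : gap n <= kap * S n /\
    \int[(P \x Q)%E]_(z in Om `*` Om') (oplus (f n \- fs) (g n \- gs) z ^+ 2) <= kap ^+ 2 * S n.
  have G := gap_le_slope heps hPcompact hQcompact hL hc bfs bgs (bf n) (bg n).
  have := quadratic_growth heps hPcompact hQcompact hL hc bfs bgs hfs hgs foc1 foc2
    (bf n) (bg n) hPconvex hrho hlambda hrho_bounds mQ0 mQ1 N0 mQP mPP diamN epsM (@hM n).
  move: G; set G := - dGamma _ _ _ _ _ _ _ _; set I := \int[_]_(z in _) _ => gapG qg.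
  have G0 : 0 <= G by exact: le_trans (gap0 n) gapG.
  have IG : I <= kap * G.
    rewrite -(ler_pM2l mP0) (le_trans qg)// /kap gammaE.
    rewrite (_ : mP * _ = 16 * (N%:R ^+ (d + 2) * (LambdaP ^+ 2 / lambdaP ^+ 2) / mQ) * M * G); last first.
      by field; rewrite !lt0r_neq0.
    rewrite ler_wpM2r// ler_wpM2r ?(ltW M0)// ler_wpM2l//.
    by rewrite ler_wpM2r ?invr_ge0 ?(ltW mQ0)// ler_wpM2l ?exprn_ge0.
  have [GS IS] := polyak hPcompact hQcompact hL hc bfs bgs (bf n) (bg n) kap0 IG.
  by split=> //; exact: le_trans gapG GS.
have contract n : gap n.+1 <= (1 - q) * gap n.
  have [h _] := pl n; have hd' := descent n.
  have : q * gap n <= A / 2 * S n.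
    rewrite qE (_ : A / 2 * S n = A / (2 * kap) * (kap * S n)); last first.
      by field; exact: lt0r_neq0.
    by rewrite ler_wpM2l// divr_ge0 ?(ltW A0)// mulr_ge0// ltW.
  by lra.
have rate n : gap n <= (1 - q) ^+ n * gap 0%N.
  elim: n => [|n IHn]; first by rewrite expr0 mul1r.
  rewrite (le_trans (contract n))// exprS -mulrA ler_wpM2l// subr_ge0//.
move=> n; split.
- have [[_ [Bf fB]] [_ [Bg gB]]] := (bmeasB (bf n) bfs, bmeasB (bg n) bgs).
  have [s1 s1E s1P] := supnorm_fin Om0 fB; have [s2 s2E s2P] := supnorm_fin Om'0 gB.
  have -> : supnorm Om (f n \- fs) = s1%:E := s1E.
  have -> : supnorm Om' (g n \- gs) = s2%:E := s2E.
  rewrite -EFin_max; set s := Num.max s1 s2.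
  have i1 x : Om x -> - s <= f n x - fs x <= s.
    by move=> Ox; rewrite -ler_norml (le_trans (s1P x Ox))// le_max lexx.
  have i2 y : Om' y -> - s <= gs y - g n y <= s.
    by move=> Oy; rewrite -ler_norml distrC (le_trans (s2P y Oy))// le_max lexx orbT.
  have [h1 h2] := hfg n.
  have i1' x : Om x -> - s <= f n.+1 x - fs x <= s.
    by move=> Ox; rewrite h1//; exact: step1 (bf n) (bg n) i1 i2 x Ox.
  have i2' y : Om' y -> - s <= gs y - g n.+1 y <= s.
    by move=> Oy; rewrite h2//; exact: step2 (bf n.+1) (bg n) i1' i2 y Oy.
  rewrite ge_max; apply/andP; split; apply: supnorm_le => x Ox.
    by rewrite ler_norml; exact: i1'.
  by rewrite /= distrC ler_norml; exact: i2'.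
- by rewrite !DeltaE -EFinM lee_fin.
- have [_ IS] := pl n; have hd' := descent n.
  rewrite sqr_Lnorm2 DeltaE -!EFinM.
  have bh : bmeas (Om `*` Om') (oplus (f n \- fs) (g n \- gs)).
    exact: (bmeas_oplus mOm mOm' (bmeasB (bf n) bfs) (bmeasB (bg n) bgs)).
  have -> : (\int[(P \x Q)%E]_z ((((oplus (f n) (g n) \- oplus fs gs) \_ (Om `*` Om')) z) ^+ 2)%:E)%E =
      (\int[(P \x Q)%E]_(z in Om `*` Om') (oplus (f n \- fs) (g n \- gs) z ^+ 2))%:E.
    rewrite -EFin_RintegralE//; last exact: bmeasX.
    rewrite [RHS]integral_mkcond; apply: eq_integral => z _; rewrite !patchE.
    case: ifP => _; last by rewrite expr0n.
    by congr (_ ^+ 2)%:E; rewrite /oplus/=; ring.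
  rewrite lee_fin (le_trans IS)//.
  have SA : S n <= 2 / A * gap n.
    rewrite -(ler_pM2l (_ : 0 < A / 2)) ?divr_gt0//.
    rewrite (_ : A / 2 * (2 / A * gap n) = gap n); last by field; exact: lt0r_neq0.
    by have := gap0 n.+1; lra.
  have kap2 : 0 <= kap ^+ 2 by exact: sqr_ge0.
  apply: (le_trans (ler_wpM2l kap2 SA)).
  apply: (@le_trans _ _ (kap ^+ 2 * (2 / A * ((1 - q) ^+ n * gap 0%N)))).
    rewrite ler_wpM2l// ler_wpM2l// divr_ge0 ?(ltW A0)//.
  by rewrite le_eqVlt; apply/orP; left; apply/eqP; rewrite /kap -/A; field; exact: lt0r_neq0.
Qed.
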